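(* Let $\mathbf{C}\in\mathbb{R}^{n\times n}_{\ge0}$ and $p,q\in\Delta^n$ be given, and let $\epsilon>0$. There is an algorithm to compute an $\epsilon$-approximate optimal transport map from $p$ to $q$ with costs $\mathbf{C}$ running in time $O\left(n^2\log n\,\|\mathbf{C}\|_{\max}\,\epsilon^{-1}\right)$.
   Context: $\Delta^n=\{y\in\mathbb{R}^n_{\ge0}:\|y\|_1=1\}$. $\|\mathbf{C}\|_{\max}$ is the largest absolute value of an entry of $\mathbf{C}$. The optimal transport problem from $p$ to $q$ with costs $\mathbf{C}$ is the linear program $\min\{\langle\mathbf{C},\mathbf{X}\rangle : \mathbf{X}\in\mathbb{R}^{n\times n},\ \mathbf{X}\ge0\text{ entrywise},\ \mathbf{X}\mathbf{1}=p,\ \mathbf{X}^\top\mathbf{1}=q\}$, where $\langle\mathbf{C},\mathbf{X}\rangle=\sum_{i,j}\mathbf{C}_{ij}\mathbf{X}_{ij}$ and $\mathbf{1}$ is the all-ones vector. An $\epsilon$-approximate optimal transport map is a feasible $\mathbf{X}$ whose cost $\langle\mathbf{C},\mathbf{X}\rangle$ is at most the optimal value plus $\epsilon$ (additive error).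
   Formalization: The running time proved is O(max(n^2, n^2 log n ||C||_max/eps)), because the stated bound is 0 when C = 0 or n = 1; time is counted on a real RAM with exact unit-cost arithmetic, exp and ln. *)

(* Defs.v *)
(* MathComp-Analysis *)
From mathcomp Require Import all_boot all_order all_algebra.
From mathcomp Require Import all_classical all_reals all_analysis.

Set Implicit Arguments.
Unset Strict Implicit.
Unset Printing Implicit Defensive.

Import Order.TTheory GRing.Theory Num.Theory.
Local Open Scope classical_set_scope.
Local Open Scope ring_scope.

(** * Optimal transport *)

Definition simplex (R : realType) (n : nat) (y : 'cV[R]_n) : Prop :=
  (forall i, 0 <= y i 0) /\ \sum_i `|y i 0| = 1.

Definition ot_cost (R : realType) (n : nat) (C X : 'M[R]_n) : R :=
  \sum_i \sum_j C i j * X i j.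

Definition ot_feasible (R : realType) (n : nat) (p q : 'cV[R]_n)
    (X : 'M[R]_n) : Prop :=
  [/\ forall i j, 0 <= X i j,
      X *m const_mx 1 = p
    & X^T *m const_mx 1 = q].

(* For p and q in the simplex the feasible set is nonempty and compact, so this
   infimum is the minimum of the linear program. *)
Definition ot_value (R : realType) (n : nat) (C : 'M[R]_n) (p q : 'cV[R]_n) : R :=
  inf [set ot_cost C X | X in ot_feasible p q].

Definition approx_ot_map (R : realType) (n : nat) (C : 'M[R]_n)
    (p q : 'cV[R]_n) (eps : R) (X : 'M[R]_n) : Prop :=
  ot_feasible p q X /\ ot_cost C X <= ot_value C p q + eps.

(** * Algorithms: deterministic programs for a real RAM

   A machine has natural-number registers, and arrays of real cells; a cell is
   addressed by the name of its array and a row and a column index.  A program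
   is a finite piece of syntax, independent of the input and of its size, and
   contains no real constant except through the cast of natural numbers.

   The unit-cost operations on reals are the four field operations, exp, ln
   and the comparison <=, all exact; there is no rounding of a real to an
   integer.  The unit-cost operations on indices are addition, truncated
   subtraction and the comparison <=. *)

Inductive iexp : Type :=
| IConst of nat
| IVar of nat
| IAdd of iexp & iexp
| ISub of iexp & iexp.

Inductive rexp : Type :=
| ROfI of iexp
| RGet of nat & iexp & iexp
| RAdd of rexp & rexp
| RSub of rexp & rexp
| RMul of rexp & rexp
| RDiv of rexp & rexp
| RExp of rexp
| RLn of rexp.

Inductive bexp : Type :=
| BLeI of iexp & iexp
| BLeR of rexp & rexp
| BNot of bexp
| BAnd of bexp & bexp.

Inductive cmd : Type :=
| CSkip
| CSetI of nat & iexp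
| CSetR of nat & iexp & iexp & rexp
| CSeq of cmd & cmd
| CIf of bexp & cmd & cmd
| CWhile of bexp & cmd.

Record state (R : realType) := State {
  ireg : nat -> nat;
  rarr : nat -> nat -> nat -> R
}.

Fixpoint ieval (R : realType) (s : state R) (e : iexp) : nat :=
  match e with
  | IConst k => k
  | IVar x => ireg s x
  | IAdd e1 e2 => (ieval s e1 + ieval s e2)%N
  | ISub e1 e2 => (ieval s e1 - ieval s e2)%N
  end.

(* Division by 0 and the logarithm of a nonpositive number return 0. *)
Fixpoint reval (R : realType) (s : state R) (e : rexp) : R :=
  match e with
  | ROfI e1 => (ieval s e1)%:R
  | RGet a i j => rarr s a (ieval s i) (ieval s j)
  | RAdd e1 e2 => reval s e1 + reval s e2
  | RSub e1 e2 => reval s e1 - reval s e2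
  | RMul e1 e2 => reval s e1 * reval s e2
  | RDiv e1 e2 => if reval s e2 == 0 then 0 else reval s e1 / reval s e2
  | RExp e1 => expR (reval s e1)
  | RLn e1 => if reval s e1 <= 0 then 0 else ln (reval s e1)
  end.

Fixpoint beval (R : realType) (s : state R) (b : bexp) : bool :=
  match b with
  | BLeI e1 e2 => (ieval s e1 <= ieval s e2)%N
  | BLeR e1 e2 => reval s e1 <= reval s e2
  | BNot b1 => ~~ beval s b1
  | BAnd b1 b2 => beval s b1 && beval s b2
  end.

(* The cost of an expression is its number of nodes. *)
Fixpoint icost (e : iexp) : nat :=
  match e with
  | IConst _ | IVar _ => 1
  | IAdd e1 e2 | ISub e1 e2 => (icost e1 + icost e2).+1
  end.

Fixpoint rcost (e : rexp) : nat :=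
  match e with
  | ROfI e1 => (icost e1).+1
  | RGet _ i j => (icost i + icost j).+1
  | RAdd e1 e2 | RSub e1 e2 | RMul e1 e2 | RDiv e1 e2 =>
      (rcost e1 + rcost e2).+1
  | RExp e1 | RLn e1 => (rcost e1).+1
  end.

Fixpoint bcost (b : bexp) : nat :=
  match b with
  | BLeI e1 e2 => (icost e1 + icost e2).+1
  | BLeR e1 e2 => (rcost e1 + rcost e2).+1
  | BNot b1 => (bcost b1).+1
  | BAnd b1 b2 => (bcost b1 + bcost b2).+1
  end.

Definition set_ireg (R : realType) (s : state R) (x k : nat) : state R :=
  State (fun y => if y == x then k else ireg s y) (rarr s).

Definition set_rarr (R : realType) (s : state R) (a i j : nat) (v : R) :
    state R :=
  State (ireg s)
    (fun a' i' j' =>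
       if [&& a' == a, i' == i & j' == j] then v else rarr s a' i' j').

(* [exec c s t s'] : started in [s], the program [c] halts in [s'] after time
   [t]. *)
Inductive exec (R : realType) : cmd -> state R -> nat -> state R -> Prop :=
| exec_skip s : exec CSkip s 1 s
| exec_seti s x e :
    exec (CSetI x e) s (icost e).+1 (set_ireg s x (ieval s e))
| exec_setr s a i j e :
    exec (CSetR a i j e) s (icost i + icost j + rcost e).+1
      (set_rarr s a (ieval s i) (ieval s j) (reval s e))
| exec_seq c1 c2 s1 s2 s3 t1 t2 :
    exec c1 s1 t1 s2 -> exec c2 s2 t2 s3 ->
    exec (CSeq c1 c2) s1 (t1 + t2) s3
| exec_if_true b c1 c2 s s' t :
    beval s b -> exec c1 s t s' ->
    exec (CIf b c1 c2) s (bcost b + t).+1 s'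
| exec_if_false b c1 c2 s s' t :
    ~~ beval s b -> exec c2 s t s' ->
    exec (CIf b c1 c2) s (bcost b + t).+1 s'
| exec_while_false b c s :
    ~~ beval s b -> exec (CWhile b c) s (bcost b).+1 s
| exec_while_true b c s1 s2 s3 t1 t2 :
    beval s1 b -> exec c s1 t1 s2 -> exec (CWhile b c) s2 t2 s3 ->
    exec (CWhile b c) s1 (bcost b + t1 + t2).+1 s3.

Lemma exec_det (R : realType) (c : cmd) (s s1 s2 : state R) (t1 t2 : nat) :
  exec c s t1 s1 -> exec c s t2 s2 -> t1 = t2 /\ s1 = s2.
Proof.
move=> H1; elim: H1 t2 s2 => {c s t1 s1}
  [s|s x e|s a i j e|c1 c2 s1 s2 s3 t1 t2 _ IH1 _ IH2|b c1 c2 s s' t hb _ IH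
  |b c1 c2 s s' t hb _ IH|b c s hb|b c s1 s2 s3 t1 t2 hb _ IH1 _ IH2] t' s'' H;
  inversion H; subst => //;
  repeat match goal with
  | h : is_true (~~ ?x), h' : is_true ?x |- _ => by rewrite h' in h
  | ih : (forall t s, exec ?c ?s0 t s -> _), h : exec ?c ?s0 _ _ |- _ =>
      have [? ?] := ih _ _ h; subst; clear ih
  end; by [].
Qed.

(** * Input and output conventions *)

Definition load_mx (R : realType) (m n : nat) (A : 'M[R]_(m, n)) (i j : nat) : R :=
  match insub i, insub j with
  | Some i', Some j' => A i' j'
  | _, _ => 0
  end.

(* Register 0 holds n; arrays 0, 1, 2 and 3 hold C, p, q and eps, vectors being
   stored in column 0 and eps in cell (0, 0).  Everything else is 0. *)
Definition ot_input (R : realType) (n : nat) (C : 'M[R]_n) (p q : 'cV[R]_n)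
    (eps : R) : state R :=
  State
    (fun x => if x == 0%N then n else 0%N)
    (fun a => match a with
              | 0 => load_mx C
              | 1 => load_mx p
              | 2 => load_mx q
              | 3 => load_mx (const_mx eps : 'M[R]_1)
              | _ => fun _ _ => 0
              end).

(* The output is read in array 4. *)
Definition ot_output (R : realType) (n : nat) (s : state R) : 'M[R]_n :=
  \matrix_(i, j) rarr s 4 i j.
Arguments ot_output {R} n s.

(* Main.v *)
Require Import Defs.
From mathcomp Require Import all_boot all_order all_algebra.
From mathcomp Require Import all_classical all_reals all_analysis.
From mathcomp Require Import ring lra zify.
Set Implicit Arguments.
Unset Strict Implicit.
Unset Printing Implicit Defensive.
Import Order.TTheory GRing.Theory Num.Theory.
Local Open Scope ring_scope.

(** Divide the costs by their maximum M and call them c.  A plan whose rows sum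
to p but whose columns do not sum to q is repaired by [rounding], at a cost of
at most M per unit of missing column mass ([rounding_cost]).  So it suffices to
find a plan x that is nearly optimal for the saddle-point problem

  min over x with row sums p, max over v in [-1, 1]^n, of
     sum_ij c_ij x_ij + sum_j v_j (col_j(x) - q_j),

where col_j(x) is the mass that x puts on column j, and taking for v_j the
value -1 on the columns that miss mass and 0 elsewhere turns the duality gap
into the cost after repair ([average_gap]).

Both players use dual averaging with the joint regulariser

  r(x, v) = 52 sum_i p_i sum_j w_ij ln w_ij + sum_j col_j(x) v_j^2,
                                                   where x_ij = p_i w_ij.

A regulariser of the box alone that is strongly convex in the sup norm has range
of order n; weighting v_j^2 by the column mass brings the range of r down to
52 ln n + 1, and the strength that is left is what a bilinear game needs, because
v_j meets x only through col_j(x) (this is the area convexity of Sherman).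

Minimising r plus linear losses jointly in x and v would need an inner loop.
Instead, in each round the plan is a Gibbs distribution computed with guesses:
the last potential stands for the coming one, both in the loss and in v^2.  Then
the potential is minimised exactly against that plan, by clipping a quotient.
The plan is therefore an exact minimiser up to the linear error [drift], of the
order of the last move of the potential, and in the telescoping of the
cumulative energy this error is only paired with the move of the column masses
([energy_lower]).  Products of two moves are absorbed by the relative entropy
and by the quadratic term ([energy_step]), so the regret after t rounds is at
most 52 ln n + 21 for every t ([regret]), and the average of T plans has gap
(52 ln n + 21) / T.  About (52 ln n + 21) M / eps rounds of time O(n^2) suffice.
When n <= 1 or M <= eps no round is made: rounding the zero matrix gives the
product plan p q^T, which is good enough, and the time stays O(n^2).

For the machine, correctness is proved by weakest preconditions ([runs]), while
running times are read off the syntax: a program whose loops run at most n times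
and are nested at most d deep takes time O((n + 1)^d) ([time_bound_poly]). *)

(** * Relative entropy *)

Section Entropy.
Variable R : realType.
Implicit Types x z a : R.

(** One term of the unnormalised relative entropy, that is the Bregman divergence
of x ln x. *)
Definition kl x z : R := x * (ln x - ln z) - x + z.

Lemma expR_le_quad a : `|a| <= 1 / 2 -> expR a <= 1 + a + 2 * a ^+ 2.
Proof.
rewrite ler_norml => /andP[a1 a2].
have h := expR_ge1Dx (- a); have e0 := expR_gt0 a.
rewrite expRN in h.
have h1 : (1 - a) * expR a <= 1 by rewrite -ler_pdivlMr// div1r.
have : expR a * (1 - a) <= (1 + a + 2 * a ^+ 2) * (1 - a) by nra.
by rewrite ler_pM2r//; lra.
Qed.

Lemma ln_ge_quad a : `|a| <= 1 / 2 -> a - 2 * a ^+ 2 <= ln (1 + a).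
Proof.
rewrite ler_norml => /andP[a1 a2].
have p1 : 0 < 1 + a by lra.
have h : ln (1 + a)^-1 <= (1 + a)^-1 - 1.
  rewrite -[X in ln X](subrKC 1) le_ln1Dx//.
  have : 0 < (1 + a)^-1 by rewrite invr_gt0.
  lra.
rewrite lnV ?posrE// in h.
have h2 : (1 + a)^-1 <= 1 - a + 2 * a ^+ 2.
  by rewrite -[leLHS]mul1r ler_pdivrMr//; nra.
lra.
Qed.

Lemma ln_ratio_le x z : 0 < x -> 0 < z -> x * (ln z - ln x) <= z - x.
Proof.
move=> x0 z0.
have h : ln (z / x) <= z / x - 1.
  rewrite -[X in ln X](subrKC 1) le_ln1Dx//.
  have : 0 < z / x by rewrite divr_gt0.
  lra.
rewrite ln_div ?posrE// in h.
have -> : z - x = x * (z / x - 1) by field; rewrite gt_eqF.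
by rewrite ler_pM2l.
Qed.

Lemma kl_ge0 x z : 0 <= x -> 0 < z -> 0 <= kl x z.
Proof.
rewrite le0r => /predU1P[->|x0] z0; first by rewrite /kl mul0r !sub0r oppr0 add0r ltW.
have := ln_ratio_le x0 z0; rewrite /kl; lra.
Qed.

Lemma kl_diag x : kl x x = 0.
Proof. by rewrite /kl; ring. Qed.

(** Moving mass from z to x against a bounded slope a is paid for by the entropy,
up to a second-order term.  This is Fenchel's inequality for [kl] in x; the
second-order term carries the old mass z. *)
Lemma kl_transport_old x z a : 0 <= x -> 0 < z -> `|a| <= 1 / 2 ->
  (x - z) * a <= kl x z + 2 * (z * a ^+ 2).
Proof.
move=> x0 z0 ha.
have ea := expR_le_quad ha; have := ha; rewrite ler_norml => /andP[a1 a2].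
move: x0; rewrite le0r => /predU1P[->|x0].
  rewrite /kl mul0r !sub0r; nra.
have := ln_ratio_le x0 (mulr_gt0 z0 (expR_gt0 a)).
rewrite lnM ?posrE ?expR_gt0// expRK /kl; nra.
Qed.

(** The same trade with the new mass x in the second-order term, obtained by
optimising over z instead of x. *)
Lemma kl_transport_new x z a : 0 <= x -> 0 < z -> `|a| <= 1 / 2 ->
  (x - z) * a <= kl x z + 2 * (x * a ^+ 2).
Proof.
move=> x0 z0 ha.
have la := ln_ge_quad ha; have := ha; rewrite ler_norml => /andP[a1 a2].
have a0 : 0 < 1 + a by lra.
move: x0; rewrite le0r => /predU1P[->|x0].
  rewrite /kl mul0r !sub0r; nra.
have := ln_ratio_le x0 (mulr_gt0 z0 a0).
rewrite lnM ?posrE// /kl; nra.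
Qed.

End Entropy.

(** * The two-player iteration and its regret *)

Section Iteration.
Variables (R : realType) (n : nat).
Variables (c : 'I_n -> 'I_n -> R) (p q : 'I_n -> R).
Implicit Types (w : 'I_n -> 'I_n -> R) (y v : 'I_n -> R).

(** The row-wise minimiser of the linear loss t c + d plus 52 times the entropy.
The temperature is 52 = 36 + 16: in [energy_step] the relative entropy has to
pay 36 times for the drift and 16 times for the cross term of the regulariser. *)
Definition gibbs (t : nat) (d : 'I_n -> R) (i j : 'I_n) : R :=
  expR (- ((t%:R * c i j + d j) / 52)) /
  \sum_k expR (- ((t%:R * c i k + d k) / 52)).

Definition colmass w (j : 'I_n) : R := \sum_i p i * w i j.

Definition clip (z : R) : R := if 1 <= z then 1 else if z <= -1 then -1 else z.

(** The dual memory of the iteration: the current potential, the sum of all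
potentials so far, and the sum of all column masses so far. *)
Record dual := Dual { potential : 'I_n -> R; past : 'I_n -> R; load : 'I_n -> R }.

(** The last potential already occurs in [past]; it is added once more as a
prediction of the coming one.  Its square is the gradient in x of the quadratic
part of the regulariser, frozen at the last potential. *)
Definition penalty (z : dual) (j : 'I_n) : R :=
  past z j + potential z j + potential z j ^+ 2.

Definition next_load (t : nat) (z : dual) (j : 'I_n) : R :=
  load z j + colmass (gibbs t.+1 (penalty z)) j.

Definition next_potential (t : nat) (z : dual) (j : 'I_n) : R :=
  clip ((next_load t z j - t.+1%:R * q j) /
        (2 * colmass (gibbs t.+1 (penalty z)) j)).

Fixpoint iterate (t : nat) : dual :=
  if t is t'.+1 then
    let z := iterate t' in
    Dual (next_potential t' z) (fun j => past z j + next_potential t' z j)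
         (next_load t' z)
  else Dual (fun=> 0) (fun=> 0) (fun=> 0).

Definition plan (t : nat) : 'I_n -> 'I_n -> R :=
  if t is t'.+1 then gibbs t (penalty (iterate t')) else gibbs 0 (fun=> 0).

Local Notation y_ t := (potential (iterate t)).
Local Notation Y_ t := (past (iterate t)).
Local Notation S_ t := (load (iterate t)).

Hypothesis p_ge0 : forall i, 0 <= p i.
Hypothesis p_sum : \sum_i p i = 1.

Lemma clip_itv z : -1 <= clip z <= 1.
Proof.
rewrite /clip; case: ifPn => [_|]; first by lra.
rewrite -ltNge => h; case: ifPn; first by lra.
by rewrite -ltNge => h2; lra.
Qed.

Lemma potential_itv t j : -1 <= y_ t j <= 1.
Proof. by case: t => [|t] /=; [lra | exact: clip_itv]. Qed.

Definition stoch w := (forall i j, 0 <= w i j) /\ (forall i, \sum_j w i j = 1).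

Lemma gibbs_gt0 t d i j : 0 < gibbs t d i j.
Proof.
rewrite divr_gt0 ?expR_gt0// (bigD1 j)//= ltr_wpDr ?expR_gt0//.
by apply: sumr_ge0 => k _; exact: expR_ge0.
Qed.

Lemma gibbs_sum t d i : \sum_j gibbs t d i j = 1.
Proof.
rewrite -mulr_suml mulfV// gt_eqF// (bigD1 i)//= ltr_wpDr ?expR_gt0//.
by apply: sumr_ge0 => k _; exact: expR_ge0.
Qed.

(** First-order optimality of the Gibbs distribution: the gradient is constant
along each row. *)
Lemma gibbs_ln t d i : exists K : R,
  forall j, t%:R * c i j + d j = K - 52 * ln (gibbs t d i j).
Proof.
exists (- 52 * ln (\sum_k expR (- ((t%:R * c i k + d k) / 52)))) => j.
rewrite ln_div ?posrE ?expR_gt0 ?expRK//; first by field.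
rewrite (bigD1 j)//= ltr_wpDr ?expR_gt0//.
by apply: sumr_ge0 => k _; exact: expR_ge0.
Qed.

Lemma plan_gt0 t i j : 0 < plan t i j.
Proof. by case: t => [|t]; exact: gibbs_gt0. Qed.

Lemma plan_stoch t : stoch (plan t).
Proof.
split=> [i j|i]; first exact/ltW/plan_gt0.
by case: t => [|t]; exact: gibbs_sum.
Qed.

Lemma colmass_ge0 w j : stoch w -> 0 <= colmass w j.
Proof. by case=> w0 _; apply: sumr_ge0 => i _; rewrite mulr_ge0. Qed.

Lemma colmass_sum w : stoch w -> \sum_j colmass w j = 1.
Proof.
case=> _ w1; rewrite exchange_big/= -[RHS]p_sum; apply: eq_bigr => i _.
by rewrite -mulr_sumr w1 mulr1.
Qed.

Lemma colmass_gt0 w j : (forall i, 0 < w i j) -> 0 < colmass w j.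
Proof.
move=> w0; rewrite lt0r sumr_ge0 ?andbT; last first.
  by move=> i _; rewrite mulr_ge0// ltW.
apply/eqP => h.
have h0 : forall i, p i = 0.
  move=> i; have /eqP : p i * w i j = 0.
    apply: (psumr_eq0P _ h) => // k _; by rewrite mulr_ge0// ltW.
  by rewrite mulf_eq0 (gt_eqF (w0 i)) orbF => /eqP.
by have := p_sum; rewrite big1// => /eqP; rewrite eq_sym oner_eq0.
Qed.

Lemma colmass_dot w v : \sum_i p i * \sum_j w i j * v j = \sum_j colmass w j * v j.
Proof.
under eq_bigr do rewrite mulr_sumr.
rewrite exchange_big/=; apply: eq_bigr => j _.
by rewrite mulr_suml; apply: eq_bigr => i _; rewrite mulrA.
Qed.

Definition KL w w' : R := \sum_i p i * \sum_j kl (w i j) (w' i j).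

Lemma KL_ge0 w t : stoch w -> 0 <= KL w (plan t).
Proof.
case=> w0 _; apply: sumr_ge0 => i _; rewrite mulr_ge0//.
by apply: sumr_ge0 => j _; rewrite kl_ge0// plan_gt0.
Qed.

Lemma KL_diag w : KL w w = 0.
Proof.
rewrite /KL big1// => i _; rewrite big1 ?mulr0// => j _; exact: kl_diag.
Qed.

(** [kl_transport_old], summed over the entries of a plan. *)
Lemma KL_transport_old w t v : stoch w -> (forall j, `|v j| <= 1 / 2) ->
  \sum_j (colmass w j - colmass (plan t) j) * v j <=
  KL w (plan t) + 2 * \sum_j colmass (plan t) j * v j ^+ 2.
Proof.
move=> [w0 _] hv; rewrite /KL.
under eq_bigr do rewrite mulrBl.
rewrite sumrB -!colmass_dot -sumrB mulr_sumr -big_split/=.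
apply: ler_sum => i _; rewrite [2 * _]mulrCA -mulrBr -mulrDr ler_wpM2l//.
rewrite -sumrB mulr_sumr -big_split/=; apply: ler_sum => j _.
by rewrite -mulrBl; apply: kl_transport_old => //; exact: plan_gt0.
Qed.

(** [kl_transport_new], summed over the entries of a plan. *)
Lemma KL_transport_new w t v : stoch w -> (forall j, `|v j| <= 1 / 2) ->
  \sum_j (colmass w j - colmass (plan t) j) * v j <=
  KL w (plan t) + 2 * \sum_j colmass w j * v j ^+ 2.
Proof.
move=> [w0 _] hv; rewrite /KL.
under eq_bigr do rewrite mulrBl.
rewrite sumrB -!colmass_dot -sumrB mulr_sumr -big_split/=.
apply: ler_sum => i _; rewrite [2 * _]mulrCA -mulrBr -mulrDr ler_wpM2l//.
rewrite -sumrB mulr_sumr -big_split/=; apply: ler_sum => j _.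
by rewrite -mulrBl; apply: kl_transport_new => //; exact: plan_gt0.
Qed.

(** The linear losses that both players have met in rounds 1 to t, plus the
regulariser. *)
Definition energy (t : nat) w v : R :=
  \sum_i p i * \sum_j w i j * (t%:R * c i j + Y_ t j + 52 * ln (w i j)) +
  \sum_j ((t%:R * q j - S_ t j) * v j + colmass w j * v j ^+ 2).

(** The move of the potential in round t.  Nothing moves in round 0, where the
plan is uniform and the potential is zero. *)
Definition step (t : nat) (j : 'I_n) : R :=
  if t is t'.+1 then y_ t j - y_ t' j else 0.

(** The gradient in x of [energy t] at the pair played in round t minus the
gradient that the plan was computed with: y_t - y_(t-1) from the prediction and
y_t^2 - y_(t-1)^2 from the frozen square. *)
Definition drift (t : nat) (j : 'I_n) : R :=
  if t is t'.+1 then step t j * (1 + y_ t j + y_ t' j) else 0.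

(** Since the plan of round t minimises the guessed energy, every other plan pays
its relative entropy to it, except for the wrong guess. *)
Lemma entropic_part t : exists K : R, forall w, stoch w ->
  \sum_i p i * \sum_j w i j * (t%:R * c i j + Y_ t j + 52 * ln (w i j)) =
  K + 52 * KL w (plan t) + \sum_j colmass w j * (drift t j - y_ t j ^+ 2).
Proof.
have [K KE] : exists K : 'I_n -> R, forall i j, t%:R * c i j + Y_ t j =
    K i - 52 * ln (plan t i j) + (drift t j - y_ t j ^+ 2).
  case: t => [|t].
    have /choice[K KE] := gibbs_ln 0 (fun=> 0).
    exists K => i j; have := KE i j => /= <-; by rewrite expr0n/=; ring.
  have /choice[K KE] := gibbs_ln t.+1 (penalty (iterate t)).
  exists K => i j; have /= <- := KE i j.
  by rewrite /penalty /=; ring.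
exists (\sum_i p i * K i) => w [w0 w1].
rewrite -colmass_dot /KL mulr_sumr -!big_split/=; apply: eq_bigr => i _.
rewrite [52 * _]mulrCA -!mulrDr; congr (_ * _).
have {1}-> : K i = \sum_j w i j * K i by rewrite -mulr_suml w1 mul1r.
rewrite mulr_sumr -!big_split/=.
(* [kl] is unnormalised; its linear terms cancel along the row. *)
have h0 : \sum_j (w i j - plan t i j) = 0.
  by rewrite sumrB w1 (proj2 (plan_stoch t)) subrr.
apply/eqP; rewrite -subr_eq0 -sumrB; apply/eqP.
rewrite -[RHS](mulr0 52) -[in RHS]h0 mulr_sumr.
by apply: eq_bigr => j _; rewrite KE /kl; ring.
Qed.

(** The variational inequality of the minimiser of s v^2 - h v over [-1, 1]. *)
Lemma clip_optimal (s h v : R) : 0 < s -> -1 <= v <= 1 ->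
  0 <= (2 * s * clip (h / (2 * s)) - h) * (v - clip (h / (2 * s))).
Proof.
move=> s0 /andP[v1 v2]; have s2 : 0 < 2 * s by lra.
rewrite /clip ler_pdivlMr// ler_pdivrMr//.
case: ifPn => [h1|]; first by nra.
rewrite -ltNge => h1; case: ifPn => [h2|]; first by nra.
have -> : 2 * s * (h / (2 * s)) = h by field; rewrite gt_eqF.
by rewrite subrr mul0r.
Qed.

(** The pair played in round t nearly minimises the energy: the Bregman divergence
of the regulariser is a lower bound for the excess of any other pair, up to the
drift paired with the difference of column masses. *)
Lemma energy_lower t w v : stoch w -> (forall j, -1 <= v j <= 1) ->
  energy t (plan t) (y_ t) + 52 * KL w (plan t)
  + \sum_j (colmass w j - colmass (plan t) j) * drift t j
  + \sum_j (colmass w j * (v j - y_ t j) ^+ 2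
            + 2 * (colmass w j - colmass (plan t) j) * y_ t j * (v j - y_ t j))
  <= energy t w v.
Proof.
move=> sw hv; have [K KE] := entropic_part t.
rewrite /energy !KE//; last exact: plan_stoch.
rewrite KL_diag mulr0 addr0.
suff : \sum_j (colmass (plan t) j * (drift t j - y_ t j ^+ 2)
    + ((t%:R * q j - S_ t j) * y_ t j + colmass (plan t) j * y_ t j ^+ 2)
    + (colmass w j - colmass (plan t) j) * drift t j
    + (colmass w j * (v j - y_ t j) ^+ 2
       + 2 * (colmass w j - colmass (plan t) j) * y_ t j * (v j - y_ t j)))
  <= \sum_j (colmass w j * (drift t j - y_ t j ^+ 2)
    + ((t%:R * q j - S_ t j) * v j + colmass w j * v j ^+ 2)).
  by rewrite !big_split/=; lra.
apply: ler_sum => j _.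
suff : 0 <= (2 * colmass (plan t) j * y_ t j - (S_ t j - t%:R * q j)) * (v j - y_ t j).
  nra.
case: t {KE} => [|t]; first by rewrite /= [leRHS](_ : _ = 0)//; ring.
apply: clip_optimal => //; apply: colmass_gt0 => i; exact: gibbs_gt0.
Qed.


Lemma drift_step t j : `|drift t j| <= 3 * `|step t j|.
Proof.
case: t => [|t]; first by rewrite /= normr0 mulr0.
rewrite /drift normrM mulrC ler_wpM2r//.
have := potential_itv t j; have := potential_itv t.+1 j.
by rewrite ler_norml => /andP[? ?] /andP[? ?]; apply/andP; split; lra.
Qed.

Lemma step_le2 t j : `|step t j| <= 2.
Proof.
case: t => [|t]; first by rewrite /= normr0; lra.
have := potential_itv t j; have := potential_itv t.+1 j.
by rewrite /step ler_norml => /andP[? ?] /andP[? ?]; apply/andP; split; lra.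
Qed.

(** The part of the Bregman divergence that is quadratic in the potential. *)
Definition movement (t : nat) : R := \sum_j colmass (plan t) j * step t j ^+ 2.

(** The absorption of second-order errors.  By [KL_transport_old] the drift of
round t costs 36 units of relative entropy and half of [movement t]; by
[KL_transport_new] the cross term of the divergence costs 16 units and half of
[movement t.+1].  The two halves telescope. *)
Lemma energy_step t :
  energy t (plan t) (y_ t) + movement t.+1 / 2 - movement t / 2
  <= energy t (plan t.+1) (y_ t.+1).
Proof.
have sw := plan_stoch t.+1.
have low := @energy_lower t (plan t.+1) (y_ t.+1) sw (potential_itv t.+1).
apply: (le_trans _ low) => {low}.
have h1 := @KL_transport_old (plan t.+1) t (fun j => - drift t j / 36) sw.
have h2 := @KL_transport_new (plan t.+1) t (fun j => - (y_ t j * step t.+1 j) / 8) sw.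
have {}h1 := h1 _; have {}h2 := h2 _.
have e1 : 36 * \sum_j (colmass (plan t.+1) j - colmass (plan t) j) * (- drift t j / 36)
   = - \sum_j (colmass (plan t.+1) j - colmass (plan t) j) * drift t j.
  by rewrite mulr_sumr -sumrN; apply: eq_bigr => j _; field.
have e2 : 16 * \sum_j (colmass (plan t.+1) j - colmass (plan t) j) *
      (- (y_ t j * step t.+1 j) / 8)
   = - \sum_j 2 * (colmass (plan t.+1) j - colmass (plan t) j) * y_ t j * step t.+1 j.
  by rewrite mulr_sumr -sumrN; apply: eq_bigr => j _; field.
have b1 : 72 * \sum_j colmass (plan t) j * (- drift t j / 36) ^+ 2 <= movement t / 2.
  rewrite mulr_sumr /movement mulr_suml; apply: ler_sum => j _.
  have s0 := colmass_ge0 j (plan_stoch t).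
  have d3 := drift_step t j.
  have {}d3 : drift t j ^+ 2 <= 9 * step t j ^+ 2.
    rewrite -real_normK ?num_real// -[X in _ <= 9 * X]real_normK ?num_real//.
    have := normr_ge0 (drift t j); nra.
  rewrite expr_div_n sqrrN; nra.
have b2 : 32 * \sum_j colmass (plan t.+1) j * (- (y_ t j * step t.+1 j) / 8) ^+ 2
   <= movement t.+1 / 2.
  rewrite mulr_sumr /movement mulr_suml; apply: ler_sum => j _.
  have s0 := colmass_ge0 j sw.
  have /andP[y1 y2] := potential_itv t j.
  have {y1 y2}yy : y_ t j ^+ 2 <= 1 by nra.
  have := sqr_ge0 (step t.+1 j); rewrite expr_div_n sqrrN exprMn => q0.
  have : y_ t j ^+ 2 * step t.+1 j ^+ 2 <= step t.+1 j ^+ 2 by nra.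
  nra.
have {}h1 : \sum_j (colmass (plan t.+1) j - colmass (plan t) j) * (- drift t j / 36) <=
    KL (plan t.+1) (plan t) + 2 * \sum_j colmass (plan t) j * (- drift t j / 36) ^+ 2.
  apply: h1 => j; rewrite normrM normrN [`|36^-1|]gtr0_norm//.
  have := drift_step t j; have := step_le2 t j; lra.
have {}h2 : \sum_j (colmass (plan t.+1) j - colmass (plan t) j) *
      (- (y_ t j * step t.+1 j) / 8) <=
    KL (plan t.+1) (plan t) +
    2 * \sum_j colmass (plan t.+1) j * (- (y_ t j * step t.+1 j) / 8) ^+ 2.
  apply: h2 => j; rewrite normrM normrN normrM [`|8^-1|]gtr0_norm//.
  have y1 : `|y_ t j| <= 1 by rewrite ler_norml potential_itv.
  have := ler_pM (normr_ge0 _) (normr_ge0 _) y1 (step_le2 t.+1 j).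
  lra.
rewrite big_split/= -[\sum_i _ * _ ^+ 2]/(movement t.+1).
rewrite -[\sum_i 2 * _ * _ * _]/(\sum_j 2 * (colmass (plan t.+1) j
  - colmass (plan t) j) * y_ t j * step t.+1 j).
lra.
Qed.

Definition total (t : nat) (i j : 'I_n) : R := \sum_(k < t) p i * plan k.+1 i j.

(** The loss of round t + 1 is bilinear in the pair that was played, so that at
this very pair the two interaction terms cancel. *)
Lemma energyS t w v : energy t.+1 w v = energy t w v
  + \sum_i p i * \sum_j w i j * c i j + \sum_j colmass w j * y_ t.+1 j
  + \sum_j (q j - colmass (plan t.+1) j) * v j.
Proof.
rewrite -[X in _ + X + _]colmass_dot /energy.
have -> : \sum_i p i * \sum_j w i j * (t.+1%:R * c i j + Y_ t.+1 j + 52 * ln (w i j))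
   = \sum_i p i * \sum_j w i j * (t%:R * c i j + Y_ t j + 52 * ln (w i j))
   + \sum_i p i * \sum_j w i j * c i j + \sum_i p i * \sum_j w i j * y_ t.+1 j.
  rewrite -!big_split/=; apply: eq_bigr => i _; rewrite -!mulrDr -!big_split/=.
  by congr (_ * _); apply: eq_bigr => j _; rewrite -natr1; ring.
have -> : \sum_j ((t.+1%:R * q j - S_ t.+1 j) * v j + colmass w j * v j ^+ 2)
   = \sum_j ((t%:R * q j - S_ t j) * v j + colmass w j * v j ^+ 2)
   + \sum_j (q j - colmass (plan t.+1) j) * v j.
  rewrite -big_split/=; apply: eq_bigr => j _.
  by rewrite /next_load -natr1; ring.
by ring.
Qed.

Lemma cost_by_rows w : \sum_i \sum_j c i j * (p i * w i j) =
  \sum_i p i * \sum_j w i j * c i j.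
Proof.
apply: eq_bigr => i _; rewrite mulr_sumr; apply: eq_bigr => j _; ring.
Qed.

Lemma load_total t j : S_ t j = \sum_i total t i j.
Proof.
elim: t => [|t IH]; first by rewrite big1// => i _; rewrite /total big_ord0.
rewrite /= /next_load IH -big_split/=; apply: eq_bigr => i _.
by rewrite /total big_ord_recr.
Qed.

(** Telescoping [energy_step]: the energy of the current pair dominates the losses
actually suffered, up to the entropy 52 ln n of the uniform start. *)
Lemma energy_played t :
  \sum_i \sum_j c i j * total t i j + \sum_j q j * Y_ t j - 52 * ln n%:R
  <= energy t (plan t) (y_ t) - movement t / 2.
Proof.
elim: t => [|t IH].
  have -> : movement 0 = 0 by rewrite /movement big1// => j _ /=; ring.
  have -> : \sum_j q j * Y_ 0 j = 0 by rewrite big1// => j _; rewrite mulr0.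
  rewrite big1 => [|i _]; last first.
    by rewrite big1// => j _; rewrite /total big_ord0 mulr0.
  rewrite /energy [X in _ <= _ + X - _]big1 /= => [|j _]; last by ring.
  rewrite mul0r subr0 !add0r addr0.
  have n0 : (0 < n)%N.
    case: (posnP n) => // n0; move: p_sum; rewrite big1; last first.
      by move=> [i hi]; exfalso; rewrite n0 in hi.
    by move/eqP; rewrite eq_sym oner_eq0.
  have E i j : gibbs 0 (fun=> 0) i j = n%:R^-1.
    rewrite /gibbs mul0r addr0 mul0r oppr0 expR0.
    under eq_bigr do rewrite mul0r addr0 mul0r oppr0 expR0.
    by rewrite sumr_const card_ord div1r.
  under eq_bigr => i _ do under eq_bigr => j _ do
    rewrite mul0r !add0r E lnV ?posrE ?ltr0n//.
  rewrite -mulr_suml p_sum mul1r sumr_const card_ord.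
  rewrite -(mulr_natl (n%:R^-1 * (52 * - ln n%:R))) .
  suff -> : n%:R * (n%:R^-1 * (52 * - ln n%:R)) = - (52 * ln n%:R) :> R by [].
  by field; rewrite pnatr_eq0 -lt0n.
have h := energy_step t; rewrite energyS -cost_by_rows//.
have -> : \sum_i \sum_j c i j * total t.+1 i j =
    \sum_i \sum_j c i j * total t i j + \sum_i \sum_j c i j * (p i * plan t.+1 i j).
  rewrite -big_split/=; apply: eq_bigr => i _; rewrite -big_split/=.
  by apply: eq_bigr => j _; rewrite /total big_ord_recr/= mulrDr.
have -> : \sum_j q j * Y_ t.+1 j = \sum_j q j * Y_ t j
    + \sum_j colmass (plan t.+1) j * y_ t.+1 j
    + \sum_j (q j - colmass (plan t.+1) j) * y_ t.+1 j.
  rewrite -!big_split; apply: eq_bigr => j _ /=; ring.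
lra.
Qed.

(** The comparator is any transport plan p_i w_ij with column sums q and any v in
the box.  Of the 21, the drift of the last round takes 12, the cross term of the
divergence takes 8 and the quadratic part of the regulariser takes 1. *)
Theorem regret t w v : stoch w -> (forall j, colmass w j = q j) ->
  (forall j, -1 <= v j <= 1) ->
  \sum_i \sum_j c i j * total t i j
  + \sum_j (\sum_i total t i j - t%:R * q j) * v j
  <= t%:R * (\sum_i \sum_j c i j * (p i * w i j)) + 52 * ln n%:R + 21.
Proof.
move=> sw hq hv.
have low := @energy_lower t w v sw hv.
have pl := energy_played t.
have mov : 0 <= movement t.
  by apply: sumr_ge0 => j _; rewrite mulr_ge0 ?sqr_ge0// colmass_ge0//; exact: plan_stoch.
have kl0 := KL_ge0 t sw.
have sp := plan_stoch t.
have b1 : - 12 <= \sum_j (colmass w j - colmass (plan t) j) * drift t j.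
  have -> : - 12 = \sum_j (- 6) * (colmass w j + colmass (plan t) j).
    by rewrite -mulr_sumr big_split/= !colmass_sum//; lra.
  apply: ler_sum => j _.
  have s1 := colmass_ge0 j sw; have s2 := colmass_ge0 j sp.
  have : `|drift t j| <= 6 by have := drift_step t j; have := step_le2 t j; lra.
  by rewrite ler_norml => /andP[? ?]; nra.
have b2 : - 8 <= \sum_j (colmass w j * (v j - y_ t j) ^+ 2
    + 2 * (colmass w j - colmass (plan t) j) * y_ t j * (v j - y_ t j)).
  have -> : - 8 = \sum_j (- 4) * (colmass w j + colmass (plan t) j).
    by rewrite -mulr_sumr big_split/= !colmass_sum//; lra.
  apply: ler_sum => j _.
  have s1 := colmass_ge0 j sw; have s2 := colmass_ge0 j sp.
  have /andP[y1 y2] := potential_itv t j; have /andP[v1 v2] := hv j.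
  have sq := mulr_ge0 s1 (sqr_ge0 (v j - y_ t j)).
  have : -2 <= y_ t j * (v j - y_ t j) <= 2 by apply/andP; split; nra.
  move=> /andP[? ?]; nra.
have en : energy t w v <= t%:R * (\sum_i \sum_j c i j * (p i * w i j))
    + \sum_j q j * Y_ t j + 1
    - \sum_j (\sum_i total t i j - t%:R * q j) * v j.
  have h1 : \sum_i p i * \sum_j w i j * (t%:R * c i j + Y_ t j + 52 * ln (w i j))
    <= t%:R * (\sum_i \sum_j c i j * (p i * w i j)) + \sum_j q j * Y_ t j.
    under [X in _ + X]eq_bigr do rewrite -hq.
    rewrite -colmass_dot cost_by_rows// mulr_sumr -big_split/=.
    apply: ler_sum => i _; rewrite mulrCA -mulrDr ler_wpM2l//.
    rewrite mulr_sumr -big_split/=; apply: ler_sum => j _.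
    have [w0 w1] := sw.
    have : ln (w i j) <= 0.
      rewrite ln_le0// -(w1 i) (bigD1 j)//= lerDl sumr_ge0//.
    have := w0 i j; nra.
  have h2 : \sum_j ((t%:R * q j - S_ t j) * v j + colmass w j * v j ^+ 2)
     <= 1 - \sum_j (\sum_i total t i j - t%:R * q j) * v j.
    rewrite -(colmass_sum sw) -sumrB; apply: ler_sum => j _.
    have s1 := colmass_ge0 j sw; have /andP[v1 v2] := hv j.
    have vv : v j ^+ 2 <= 1 by nra.
    rewrite load_total; nra.
  rewrite /energy; lra.
lra.
Qed.

End Iteration.

(** * Repairing the column sums *)

Section Rounding.
Variables (R : realType) (n : nat) (p q : 'I_n -> R) (X : 'I_n -> 'I_n -> R).

Definition colsum (j : 'I_n) : R := \sum_i X i j.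

(** Scaling down the overfull columns leaves row and column deficits, which a
rank-one matrix fills.  A zero deficit makes that matrix zero. *)
Definition trim (i j : 'I_n) : R :=
  if colsum j <= q j then X i j else X i j * q j / colsum j.

Definition row_deficit (i : 'I_n) : R := p i - \sum_j trim i j.

Definition col_deficit (j : 'I_n) : R :=
  if colsum j <= q j then q j - colsum j else 0.

Definition deficit : R := \sum_j col_deficit j.

Definition rounding (i j : 'I_n) : R :=
  trim i j + row_deficit i * col_deficit j / deficit.

Hypotheses (q_ge0 : forall j, 0 <= q j).
Hypotheses (p_sum : \sum_i p i = 1) (q_sum : \sum_j q j = 1).
Hypotheses (X_ge0 : forall i j, 0 <= X i j) (X_row : forall i, \sum_j X i j <= p i).

Lemma trim_ge0 i j : 0 <= trim i j.
Proof.
rewrite /trim; case: ifPn => // h.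
by rewrite divr_ge0 ?mulr_ge0// sumr_ge0.
Qed.

Lemma trim_le i j : trim i j <= X i j.
Proof.
rewrite /trim; case: ifPn => //; rewrite -ltNge => h.
have s0 : 0 < colsum j by exact: le_lt_trans h.
by rewrite ler_pdivrMr// ler_wpM2l// ltW.
Qed.

Lemma trim_col j : \sum_i trim i j = q j - col_deficit j.
Proof.
rewrite /trim /col_deficit; case: ifPn => [h|].
  by rewrite -/(colsum j); ring.
rewrite -ltNge => h; rewrite -2!mulr_suml subr0 -/(colsum j).
have s0 : 0 < colsum j by exact: le_lt_trans h.
by field; rewrite gt_eqF.
Qed.

Lemma row_deficit_ge0 i : 0 <= row_deficit i.
Proof.
by rewrite subr_ge0 (le_trans _ (X_row i))//; apply: ler_sum => j _; exact: trim_le.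
Qed.

Lemma col_deficit_ge0 j : 0 <= col_deficit j.
Proof. by rewrite /col_deficit; case: ifPn => // h; rewrite subr_ge0. Qed.

Lemma deficit_ge0 : 0 <= deficit.
Proof. by apply: sumr_ge0 => j _; exact: col_deficit_ge0. Qed.

Lemma row_deficit_sum : \sum_i row_deficit i = deficit.
Proof.
rewrite sumrB p_sum exchange_big/=.
under eq_bigr do rewrite trim_col.
by rewrite sumrB q_sum /deficit; ring.
Qed.

Lemma rounding_ge0 i j : 0 <= rounding i j.
Proof.
rewrite addr_ge0 ?trim_ge0//.
by rewrite divr_ge0 ?deficit_ge0// mulr_ge0 ?row_deficit_ge0 ?col_deficit_ge0.
Qed.

Lemma rounding_row i : \sum_j rounding i j = p i.
Proof.
rewrite big_split/=; have [d0|d0] := eqVneq deficit 0.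
  have := @psumr_eq0P _ _ xpredT row_deficit (fun i _ => row_deficit_ge0 i).
  rewrite row_deficit_sum => /(_ d0) /(_ i isT) r0; rewrite [X in _ + X]big1 => [|j _].
    by move: r0; rewrite /row_deficit; lra.
  by rewrite r0 !mul0r.
rewrite -mulr_suml -mulr_sumr -/deficit mulfK// /row_deficit; lra.
Qed.

Lemma rounding_col j : \sum_i rounding i j = q j.
Proof.
rewrite big_split/= trim_col; have [d0|d0] := eqVneq deficit 0.
  have := @psumr_eq0P _ _ xpredT col_deficit (fun j _ => col_deficit_ge0 j).
  move=> /(_ d0) /(_ j isT) ->; rewrite [X in _ + X]big1 => [|i _]; first lra.
  by rewrite mulr0 mul0r.
rewrite -2!mulr_suml row_deficit_sum mulrAC mulfV// mul1r; lra.
Qed.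

Lemma rounding_cost (C : 'I_n -> 'I_n -> R) (M : R) :
  (forall i j, 0 <= C i j <= M) ->
  \sum_i \sum_j C i j * rounding i j <= \sum_i \sum_j C i j * X i j + M * deficit.
Proof.
move=> hC.
apply: (@le_trans _ _ (\sum_i \sum_j C i j * X i j +
    \sum_i \sum_j M * (row_deficit i * col_deficit j / deficit))).
  rewrite -big_split/=; apply: ler_sum => i _.
  rewrite -big_split/=; apply: ler_sum => j _.
  have /andP[c0 cM] := hC i j; rewrite mulrDr lerD ?ler_wpM2l ?trim_le//.
  rewrite ler_wpM2r//.
  by rewrite divr_ge0 ?deficit_ge0// mulr_ge0 ?row_deficit_ge0 ?col_deficit_ge0.
rewrite lerD2l; have [d0|d0] := eqVneq deficit 0.
  by rewrite d0 mulr0 big1// => i _; rewrite big1// => j _; rewrite invr0 !mulr0.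
rewrite -[X in _ <= M * X]row_deficit_sum [leRHS]mulr_sumr; apply: ler_sum => i _.
by rewrite -mulr_sumr -mulr_suml -mulr_sumr mulfK.
Qed.

End Rounding.

(** * From regret to the transport cost *)

Section Gap.
Variables (R : realType) (n : nat) (C : 'I_n -> 'I_n -> R) (p q : 'I_n -> R).
Variables (M eps : R).
Hypotheses (C_bound : forall i j, 0 <= C i j <= M) (M_gt0 : 0 < M).
Hypotheses (p_ge0 : forall i, 0 <= p i) (q_ge0 : forall i, 0 <= q i).
Hypotheses (p_sum : \sum_i p i = 1) (q_sum : \sum_j q j = 1).

Local Notation c := (fun i j => C i j / M).

Definition average (t : nat) (i j : 'I_n) : R := total c p q t i j / t%:R.

Lemma average_ge0 t i j : 0 <= average t i j.
Proof.
rewrite divr_ge0// sumr_ge0// => k _; rewrite mulr_ge0//.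
by have [/(_ i j)] := plan_stoch c p q k.+1.
Qed.

Lemma average_row t i : (0 < t)%N -> \sum_j average t i j = p i.
Proof.
move=> t0; rewrite -mulr_suml exchange_big/=.
under eq_bigr => k _ do rewrite -mulr_sumr (proj2 (plan_stoch c p q k.+1)) mulr1.
by rewrite sumr_const card_ord -(mulr_natr (p i)) mulfK// pnatr_eq0 -lt0n.
Qed.

(** [regret] against v_j = -1 on the columns that miss mass and 0 elsewhere: the
constraint term is then exactly the deficit that [rounding_cost] charges for. *)
Theorem average_gap t (U : 'I_n -> 'I_n -> R) : (0 < t)%N ->
  (52 * ln n%:R + 21) * M <= t%:R * eps ->
  (forall i j, 0 <= U i j) -> (forall i, \sum_j U i j = p i) ->
  (forall j, \sum_i U i j = q j) ->
  \sum_i \sum_j C i j * rounding p q (average t) i j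
  <= \sum_i \sum_j C i j * U i j + eps.
Proof.
move=> t0 ht U0 Ur Uc.
have tR : 0 < t%:R :> R by rewrite ltr0n.
have Xr i : \sum_j average t i j <= p i by rewrite average_row.
apply: (le_trans (rounding_cost q_ge0 p_sum q_sum (average_ge0 t) Xr C_bound)).
(* A row without mass has no conditional distribution; any one will do. *)
set w := fun i j => if p i == 0 then n%:R^-1 else U i j / p i.
have pw i j : p i * w i j = U i j.
  rewrite /w; have [p0|p0] := eqVneq (p i) 0; last by rewrite mulrCA mulfV ?mulr1.
  rewrite p0 mul0r; symmetry.
  by apply: (@psumr_eq0P _ _ xpredT (U i)) => //; rewrite Ur.
have sw : stoch w.
  split=> i.
    by move=> j; rewrite /w; case: ifP => _; rewrite ?invr_ge0// divr_ge0.
  rewrite /w; have [p0|p0] := eqVneq (p i) 0.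
    rewrite sumr_const card_ord -(mulr_natr n%:R^-1) mulVf//.
    by rewrite pnatr_eq0 -lt0n (leq_ltn_trans _ (ltn_ord i)).
  by rewrite -mulr_suml Ur mulfV.
have cw j : colmass p w j = q j.
  by rewrite -Uc; apply: eq_bigr => i _; exact: pw.
set v := fun j => if colsum (average t) j <= q j then -1 else 0 : R.
have vitv j : -1 <= v j <= 1 by rewrite /v; case: ifP => _; lra.
have := @regret _ n c p q p_ge0 p_sum t w v sw cw vitv.
have -> : \sum_i \sum_j C i j / M * total c p q t i j =
    t%:R / M * \sum_i \sum_j C i j * average t i j.
  rewrite mulr_sumr; apply: eq_bigr => i _; rewrite mulr_sumr; apply: eq_bigr => j _.
  by rewrite /average; field; rewrite !gt_eqF.
have -> : \sum_i \sum_j C i j / M * (p i * w i j) = M^-1 * \sum_i \sum_j C i j * U i j.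
  rewrite mulr_sumr; apply: eq_bigr => i _; rewrite mulr_sumr; apply: eq_bigr => j _.
  by rewrite pw; ring.
have -> : \sum_j (\sum_i total c p q t i j - t%:R * q j) * v j =
    t%:R * deficit q (average t).
  rewrite mulr_sumr; apply: eq_bigr => j _; rewrite /v /col_deficit.
  have -> : \sum_i total c p q t i j = t%:R * colsum (average t) j.
    by rewrite /colsum /average -mulr_suml mulrCA mulfV ?mulr1// gt_eqF.
  by case: ifP => _; ring.
move: (deficit _ _) (\sum_i _) (\sum_i _) => d u a h.
have : M * (t%:R / M * a + t%:R * d) <= M * (t%:R * (M^-1 * u) + (52 * ln n%:R + 21)).
  by rewrite ler_pM2l//; lra.
rewrite [leLHS](_ : _ = t%:R * (a + M * d)); last by field; rewrite gt_eqF.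
rewrite [leRHS](_ : _ = t%:R * u + (52 * ln n%:R + 21) * M); last by field; rewrite gt_eqF.
move=> h2; rewrite -(ler_pM2l tR); lra.
Qed.

End Gap.

(** * Running times from syntax, and weakest preconditions *)

Fixpoint written_arrays (c : cmd) : seq nat :=
  match c with
  | CSkip | CSetI _ _ => [::]
  | CSetR a _ _ _ => [:: a]
  | CSeq c1 c2 | CIf _ c1 c2 => written_arrays c1 ++ written_arrays c2
  | CWhile _ c1 => written_arrays c1
  end.

Fixpoint written_registers (c : cmd) : seq nat :=
  match c with
  | CSkip | CSetR _ _ _ _ => [::]
  | CSetI x _ => [:: x]
  | CSeq c1 c2 | CIf _ c1 c2 => written_registers c1 ++ written_registers c2
  | CWhile _ c1 => written_registers c1
  end.

(** A time bound for the executions in which every loop makes at most n rounds each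
time it is entered. *)
Fixpoint time_bound (n : nat) (c : cmd) : nat :=
  match c with
  | CSkip => 1
  | CSetI _ e => (icost e).+1
  | CSetR _ i j e => (icost i + icost j + rcost e).+1
  | CSeq c1 c2 => time_bound n c1 + time_bound n c2
  | CIf b c1 c2 => (bcost b + (time_bound n c1 + time_bound n c2)).+1
  | CWhile b c1 => n.+1 * (bcost b + time_bound n c1).+1
  end.

Fixpoint depth (c : cmd) : nat :=
  match c with
  | CSkip | CSetI _ _ | CSetR _ _ _ _ => 0
  | CSeq c1 c2 | CIf _ c1 c2 => maxn (depth c1) (depth c2)
  | CWhile _ c1 => (depth c1).+1
  end.

(** Reading the coefficient at n = 0 works because each loop contributes exactly
one factor n + 1. *)
Lemma time_bound_poly n c : (time_bound n c <= time_bound 0 c * n.+1 ^ depth c)%N.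
Proof.
have mono k l a : (k <= l -> a * n.+1 ^ k <= a * n.+1 ^ l)%N.
  by move=> kl; rewrite leq_mul2l leq_pexp2l ?orbT.
elim: c => [|x e|a i j e|c1 IH1 c2 IH2|b c1 IH1 c2 IH2|b c1 IH1] /=;
  rewrite ?expn0 ?muln1//.
- rewrite mulnDl leq_add//.
    exact: leq_trans IH1 (mono _ _ _ (leq_maxl _ _)).
  exact: leq_trans IH2 (mono _ _ _ (leq_maxr _ _)).
- have h0 : (0 < n.+1 ^ maxn (depth c1) (depth c2))%N by rewrite expn_gt0.
  have h1 := leq_trans IH1 (mono _ _ _ (leq_maxl _ (depth c2))).
  have h2 := leq_trans IH2 (mono _ _ _ (leq_maxr (depth c1) _)).
  nia.
- have h0 : (0 < n.+1 ^ depth c1)%N by rewrite expn_gt0.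
  rewrite mul1n expnS mulnCA leq_mul2l/=; nia.
Qed.

Section Runs.
Variable R : realType.
Implicit Types (s : state R) (c : cmd) (Q : state R -> Prop).

Definition frame c s s' : Prop :=
  (forall y, y \notin written_registers c -> ireg s' y = ireg s y) /\
  (forall a, a \notin written_arrays c -> rarr s' a = rarr s a).

Lemma exec_frame c s t s' : exec c s t s' -> frame c s s'.
Proof.
elim=> {c s t s'}
  [s|s x e|s a i j e|c1 c2 s1 s2 s3 t1 t2 _ [I1 A1] _ [I2 A2]
  |b c1 c2 s s' t _ _ [I1 A1]|b c1 c2 s s' t _ _ [I1 A1]
  |b c s _|b c s1 s2 s3 t1 t2 _ _ [I1 A1] _ [I2 A2]]; split=> z //=.
- by rewrite inE => /negPf ->.
- rewrite inE => /negPf za; apply/funext => k; apply/funext => l.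
  by rewrite za.
- by rewrite mem_cat negb_or => /andP[/I1 <- /I2 ->].
- by rewrite mem_cat negb_or => /andP[/A1 <- /A2 ->].
- by rewrite mem_cat negb_or => /andP[/I1 -> _].
- by rewrite mem_cat negb_or => /andP[/A1 -> _].
- by rewrite mem_cat negb_or => /andP[_ /I1 ->].
- by rewrite mem_cat negb_or => /andP[_ /A1 ->].
- by move=> h; rewrite I2// I1.
- by move=> h; rewrite A2// A1.
Qed.

(** Total correctness with the time bound built in, so that the rules below never
mention time. *)
Definition runs n c s Q : Prop :=
  exists t s', [/\ exec c s t s', (t <= time_bound n c)%N & Q s'].

Lemma runs_frame n c s P Q : runs n c s P ->
  (forall s', P s' -> frame c s s' -> Q s') -> runs n c s Q.
Proof.
move=> [t [s' [e h ps]]] pq; exists t, s'; split=> //.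
exact: pq ps (exec_frame e).
Qed.

Lemma runs_skip n s Q : Q s -> runs n CSkip s Q.
Proof. by move=> q; exists 1%N, s; split=> //; exact: exec_skip. Qed.

Lemma runs_seti n x e s Q :
  Q (set_ireg s x (ieval s e)) -> runs n (CSetI x e) s Q.
Proof. by move=> q; do 2 eexists; split; [exact: exec_seti| |exact: q]. Qed.

Lemma runs_setr n a i j e s Q :
  Q (set_rarr s a (ieval s i) (ieval s j) (reval s e)) ->
  runs n (CSetR a i j e) s Q.
Proof. by move=> q; do 2 eexists; split; [exact: exec_setr| |exact: q]. Qed.

Lemma runs_seq n c1 c2 s Q :
  runs n c1 s (fun s1 => runs n c2 s1 Q) -> runs n (CSeq c1 c2) s Q.
Proof.
move=> [t1 [s1 [e1 h1 [t2 [s2 [e2 h2 q]]]]]].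
by exists (t1 + t2)%N, s2; split=> //; [exact: exec_seq e1 e2|exact: leq_add].
Qed.

Lemma runs_if n b c1 c2 s Q :
  (beval s b -> runs n c1 s Q) -> (~~ beval s b -> runs n c2 s Q) ->
  runs n (CIf b c1 c2) s Q.
Proof.
move=> h1 h2; case: (boolP (beval s b)) => hb.
  have [t [s' [e h q]]] := h1 hb; exists (bcost b + t).+1, s'; split=> //.
    exact: exec_if_true.
  by rewrite /= ltnS leq_add2l (leq_trans h)// leq_addr.
have [t [s' [e h q]]] := h2 hb; exists (bcost b + t).+1, s'; split=> //.
  exact: exec_if_false.
by rewrite /= ltnS leq_add2l (leq_trans h)// leq_addl.
Qed.

(** The number T of rounds is free here: the main loop may need more than n. *)
Lemma exec_while_count n b c T (J : nat -> state R -> Prop) s :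
  (forall k s1, (k < T)%N -> J k s1 -> beval s1 b /\ runs n c s1 (J k.+1)) ->
  (forall s1, J T s1 -> ~~ beval s1 b) -> J 0%N s ->
  exists t s', [/\ exec (CWhile b c) s t s',
    (t <= T.+1 * (bcost b + time_bound n c).+1)%N & J T s'].
Proof.
move=> step stop.
suff H m : forall k s, (k + m = T)%N -> J k s -> exists t s',
    [/\ exec (CWhile b c) s t s', (t <= m.+1 * (bcost b + time_bound n c).+1)%N
      & J T s'].
  by move=> j0; exact: (H T 0%N).
elim: m => [|m IH] k s1 kT jk.
  rewrite addn0 in kT; subst k; exists (bcost b).+1, s1; split=> //.
    exact/exec_while_false/stop.
  by rewrite mul1n ltnS leq_addr.
have kT' : (k < T)%N by rewrite -kT -addSnnS leq_addr.
have [hb [t1 [s2 [e1 h1 j2]]]] := step _ _ kT' jk.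
have [|t2 [s3 [e2 h2 j3]]] := IH k.+1 s2 _ j2; first by rewrite addSnnS.
exists (bcost b + t1 + t2).+1, s3; split=> //; first exact: exec_while_true e1 e2.
by rewrite mulSn -addSn leq_add// ltnS leq_add2l.
Qed.

Definition For (x : nat) (c : cmd) : cmd :=
  CSeq (CSetI x (IConst 0))
    (CWhile (BLeI (IAdd (IVar x) (IConst 1)) (IVar 0))
       (CSeq c (CSetI x (IAdd (IVar x) (IConst 1))))).

(** The invariant speaks of the arrays only; registers and the arrays that the body
does not write are carried along by the frame. *)
Lemma runs_for n x c s (Inv : nat -> (nat -> nat -> nat -> R) -> Prop) Q :
  x \notin written_registers c -> x != 0%N -> 0%N \notin written_registers c ->
  ireg s 0 = n -> Inv 0%N (rarr s) ->
  (forall k s1, (k < n)%N -> ireg s1 x = k ->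
     (forall y, y \notin x :: written_registers c -> ireg s1 y = ireg s y) ->
     (forall a, a \notin written_arrays c -> rarr s1 a = rarr s a) ->
     Inv k (rarr s1) -> runs n c s1 (fun s2 => Inv k.+1 (rarr s2))) ->
  (forall s',
     (forall y, y \notin x :: written_registers c -> ireg s' y = ireg s y) ->
     (forall a, a \notin written_arrays c -> rarr s' a = rarr s a) ->
     Inv n (rarr s') -> Q s') ->
  runs n (For x c) s Q.
Proof.
move=> xc x0 zc sn i0 body post; apply: runs_seq; apply: runs_seti => /=.
pose J k s1 := [/\ ireg s1 x = k,
  forall y, y \notin x :: written_registers c -> ireg s1 y = ireg s y,
  forall a, a \notin written_arrays c -> rarr s1 a = rarr s a & Inv k (rarr s1)].
have z0 : 0%N \notin x :: written_registers c by rewrite inE negb_or eq_sym x0.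
have [|||t [s' [e h [_ j2 j3 j4]]]] := @exec_while_count n
    (BLeI (IAdd (IVar x) (IConst 1)) (IVar 0))
    (CSeq c (CSetI x (IAdd (IVar x) (IConst 1)))) n J (set_ireg s x 0).
- move=> k s1 kn [j1 j2 j3 j4]; split; first by rewrite /= j1 j2// sn addn1.
  apply: runs_seq; apply: (runs_frame (body k s1 kn j1 j2 j3 j4)) => s2 q [f1 f2].
  apply: runs_seti; split=> //=.
  + by rewrite eqxx f1// j1 addn1.
  + move=> y hy; have := hy; rewrite inE negb_or => /andP[/negPf -> yc].
    by rewrite f1// j2.
  + by move=> a ha; rewrite f2// j3.
- by move=> s1 [j1 j2 _ _]; rewrite /= j1 j2// sn addn1 ltnn.
- split=> //=; first by rewrite eqxx.
  by move=> y; rewrite inE negb_or => /andP[/negPf -> _].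
- by exists t, s'; split=> //; exact: post.
Qed.

Definition SumTo (a : nat) (i : iexp) (x : nat) (e : rexp) : cmd :=
  CSeq (CSetR a i (IConst 0) (ROfI (IConst 0)))
       (For x (CSetR a i (IConst 0) (RAdd (RGet a i (IConst 0)) e))).

Lemma runs_sum n a i x e s (val : nat -> R) Q :
  x != 0%N -> ireg s 0 = n ->
  (forall s1, (forall y, y != x -> ireg s1 y = ireg s y) ->
     ieval s1 i = ieval s i) ->
  (forall k s1, (k < n)%N -> ireg s1 x = k ->
     (forall y, y != x -> ireg s1 y = ireg s y) ->
     (forall b, b != a -> rarr s1 b = rarr s b) -> reval s1 e = val k) ->
  (forall s', (forall y, y != x -> ireg s' y = ireg s y) ->
     (forall b, b != a -> rarr s' b = rarr s b) ->
     (forall k l, rarr s' a k l =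
        if (k == ieval s i) && (l == 0%N) then \sum_(m < n) val m
        else rarr s a k l) -> Q s') ->
  runs n (SumTo a i x e) s Q.
Proof.
move=> x0 sn hi he hQ; apply: runs_seq; apply: runs_setr => /=.
set s0 := set_rarr _ _ _ _ _.
have FI y s1 : (forall y, y \notin [:: x] -> ireg s1 y = ireg s0 y) ->
    y != x -> ireg s1 y = ireg s y by move=> h yx; rewrite h// inE.
have FA b s1 : (forall b, b \notin [:: a] -> rarr s1 b = rarr s0 b) ->
    b != a -> rarr s1 b = rarr s b.
  move=> h ba; rewrite h ?inE//; apply/funext => k; apply/funext => l /=.
  by rewrite (negPf ba).
apply: (runs_for (Inv := fun m A => forall k l, A a k l =
  if (k == ieval s i) && (l == 0%N) then \sum_(0 <= m' < m) val m'
  else rarr s a k l)) => //.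
- by move=> k l /=; rewrite eqxx/=; case: ifP => // _; rewrite big_geq.
- move=> m s1 mn xm fi fa h; apply: runs_setr => k l /=.
  rewrite eqxx/= hi; last by move=> y; exact: FI.
  case: ifP => kl; last by rewrite h kl.
  rewrite h !eqxx/= big_nat_recr//= (he m)// => [y|b]; [exact: FI|exact: FA].
- move=> s' fi fa h; apply: hQ => [y|b|k l]; [exact: FI|exact: FA|].
  by rewrite h big_mkord.
Qed.

Lemma runs_row n a i x e s (val : nat -> R) Q :
  x != 0%N -> ireg s 0 = n -> i != x ->
  (forall m s1, (m < n)%N -> ireg s1 x = m ->
     (forall y, y != x -> ireg s1 y = ireg s y) ->
     (forall b, b != a -> rarr s1 b = rarr s b) ->
     rarr s1 a (ireg s i) m = rarr s a (ireg s i) m -> reval s1 e = val m) ->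
  (forall s', (forall y, y != x -> ireg s' y = ireg s y) ->
     (forall b, b != a -> rarr s' b = rarr s b) ->
     (forall k l, rarr s' a k l =
        if (k == ireg s i) && (l < n)%N then val l else rarr s a k l) -> Q s') ->
  runs n (For x (CSetR a (IVar i) (IVar x) e)) s Q.
Proof.
move=> x0 sn ix he hQ.
have FI y s1 : (forall y, y \notin [:: x] -> ireg s1 y = ireg s y) ->
    y != x -> ireg s1 y = ireg s y by move=> h yx; rewrite h// inE.
have FA b s1 : (forall b, b \notin [:: a] -> rarr s1 b = rarr s b) ->
    b != a -> rarr s1 b = rarr s b by move=> h ba; rewrite h// inE.
apply: (runs_for (Inv := fun m A => forall k l, A a k l =
  if (k == ireg s i) && (l < m)%N then val l else rarr s a k l)) => //.
- by move=> k l; rewrite ltn0 andbF.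
- move=> m s1 mn xm fi fa h; apply: runs_setr => k l /=.
  rewrite eqxx/= xm (FI i s1)// (he m)//.
  + rewrite h; case: (k == _) => //=.
    rewrite [(l < m.+1)%N]ltnS [(l <= m)%N]leq_eqVlt.
    by case: eqVneq => [->|].
  + by move=> y; exact: FI.
  + by move=> b; exact: FA.
  + by rewrite h ltnn andbF.
- move=> s' fi fa h; apply: hQ => [y|b|k l]; [exact: FI|exact: FA|exact: h].
Qed.

Lemma runs_col n a j x e s (val : nat -> R) Q :
  x != 0%N -> ireg s 0 = n -> j != x ->
  (forall m s1, (m < n)%N -> ireg s1 x = m ->
     (forall y, y != x -> ireg s1 y = ireg s y) ->
     (forall b, b != a -> rarr s1 b = rarr s b) ->
     rarr s1 a m (ireg s j) = rarr s a m (ireg s j) -> reval s1 e = val m) ->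
  (forall s', (forall y, y != x -> ireg s' y = ireg s y) ->
     (forall b, b != a -> rarr s' b = rarr s b) ->
     (forall k l, rarr s' a k l =
        if (k < n)%N && (l == ireg s j) then val k else rarr s a k l) -> Q s') ->
  runs n (For x (CSetR a (IVar x) (IVar j) e)) s Q.
Proof.
move=> x0 sn jx he hQ.
have FI y s1 : (forall y, y \notin [:: x] -> ireg s1 y = ireg s y) ->
    y != x -> ireg s1 y = ireg s y by move=> h yx; rewrite h// inE.
have FA b s1 : (forall b, b \notin [:: a] -> rarr s1 b = rarr s b) ->
    b != a -> rarr s1 b = rarr s b by move=> h ba; rewrite h// inE.
apply: (runs_for (Inv := fun m A => forall k l, A a k l =
  if (k < m)%N && (l == ireg s j) then val k else rarr s a k l)) => //.
- move=> m s1 mn xm fi fa h; apply: runs_setr => k l /=.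
  rewrite eqxx/= xm (FI j s1)// (he m)//.
  + rewrite h; case: (l == _); rewrite ?andbT ?andbF//=.
    rewrite [(k < m.+1)%N]ltnS [(k <= m)%N]leq_eqVlt.
    by case: eqVneq => [->|].
  + by move=> y; exact: FI.
  + by move=> b; exact: FA.
  + by rewrite h ltnn.
- move=> s' fi fa h; apply: hQ => [y|b|k l]; [exact: FI|exact: FA|exact: h].
Qed.

End Runs.

(** * The program *)

Local Notation rN := 0%N.
Local Notation rT := 1%N.
Local Notation rI := 2%N.
Local Notation rJ := 3%N.
Local Notation aC := 0%N.
Local Notation aP := 1%N.
Local Notation aQ := 2%N.
Local Notation aEps := 3%N.
Local Notation aX := 4%N.
Local Notation aMax := 5%N.
Local Notation aSum := 6%N.
Local Notation aPen := 7%N.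
Local Notation aPast := 8%N.
Local Notation aLoad := 9%N.
Local Notation aCol := 10%N.
Local Notation aPlan := 11%N.
Local Notation aPot := 12%N.
Local Notation aCdef := 13%N.
Local Notation aDef := 14%N.

Local Notation num k := (ROfI (IConst k)).
Local Notation cell a := (RGet a (IConst 0) (IConst 0)).
Local Notation vec a x := (RGet a (IVar x) (IConst 0)).
Local Notation mat a := (RGet a (IVar rI) (IVar rJ)).

Definition MaxLoop : cmd :=
  For rI (For rJ (CIf (BLeR (cell aMax) (mat aC))
                      (CSetR aMax (IConst 0) (IConst 0) (mat aC)) CSkip)).

Definition weight : rexp :=
  RExp (RSub (num 0) (RDiv (RAdd (RMul (ROfI (IVar rT)) (RDiv (mat aC) (cell aMax)))
                                 (vec aPen rJ)) (num 52))).

Definition PlanLoop : cmd :=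
  For rI (CSeq (SumTo aSum (IConst 0) rJ weight)
    (For rJ (CSeq
      (CSetR aPlan (IVar rI) (IVar rJ) (RMul (vec aP rI) (RDiv weight (cell aSum))))
      (CSetR aX (IVar rI) (IVar rJ) (RAdd (mat aX) (mat aPlan)))))).

Definition set_vec a e := CSetR a (IVar rJ) (IConst 0) e.

Definition PotentialLoop : cmd :=
  For rJ
    (CSeq (SumTo aCol (IVar rJ) rI (mat aPlan))
    (CSeq (set_vec aLoad (RAdd (vec aLoad rJ) (vec aCol rJ)))
    (CSeq (set_vec aPot
       (RDiv (RSub (vec aLoad rJ) (RMul (ROfI (IVar rT)) (vec aQ rJ)))
             (RMul (num 2) (vec aCol rJ))))
    (CSeq (CIf (BLeR (num 1) (vec aPot rJ)) (set_vec aPot (num 1))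
          (CIf (BLeR (vec aPot rJ) (RSub (num 0) (num 1)))
               (set_vec aPot (RSub (num 0) (num 1))) CSkip))
    (CSeq (set_vec aPast (RAdd (vec aPast rJ) (vec aPot rJ)))
          (set_vec aPen (RAdd (RAdd (vec aPast rJ) (vec aPot rJ))
                         (RMul (vec aPot rJ) (vec aPot rJ))))))))).

Definition Iteration : cmd :=
  CSeq (CSetI rT (IAdd (IVar rT) (IConst 1))) (CSeq PlanLoop PotentialLoop).

Definition RoundLoops : cmd :=
  CSeq (For rI (For rJ (CSetR aX (IVar rI) (IVar rJ) (RDiv (mat aX) (ROfI (IVar rT))))))
  (CSeq
   (For rJ (CSeq (SumTo aCol (IVar rJ) rI (mat aX))
     (CIf (BLeR (vec aCol rJ) (vec aQ rJ))
       (set_vec aCdef (RSub (vec aQ rJ) (vec aCol rJ)))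
       (CSeq (set_vec aCdef (num 0))
         (For rI (CSetR aX (IVar rI) (IVar rJ)
            (RDiv (RMul (mat aX) (vec aQ rJ)) (vec aCol rJ))))))))
  (CSeq (SumTo aDef (IConst 0) rJ (vec aCdef rJ))
   (For rI (CSeq (SumTo aSum (IConst 0) rJ (mat aX))
     (For rJ (CSetR aX (IVar rI) (IVar rJ)
        (RAdd (mat aX) (RDiv (RMul (RSub (vec aP rI) (cell aSum)) (vec aCdef rJ))
                             (cell aDef))))))))).

(** Comparing products spares rounding (52 ln n + 21) M / eps up to an integer,
which the machine cannot do. *)
Definition Continue : bexp :=
  BNot (BLeR (RMul (RAdd (RMul (num 52) (RLn (ROfI (IVar rN)))) (num 21)) (cell aMax))
             (RMul (ROfI (IVar rT)) (cell aEps))).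

Definition Transport : cmd :=
  CSeq MaxLoop (CSeq
    (CIf (BAnd (BLeI (IConst 2) (IVar rN)) (BNot (BLeR (cell aMax) (cell aEps))))
         (CWhile Continue Iteration) CSkip)
    RoundLoops).

(** * Correctness of the program *)

Section Specs.
Variables (R : realType) (n : nat).
Variables (C : 'I_n -> 'I_n -> R) (p q : 'I_n -> R) (eps M : R).
Implicit Types (s : state R).

Lemma divE (x y : R) : (if y == 0 then 0 else x / y) = x / y.
Proof. by case: eqP => // ->; rewrite invr0 mulr0. Qed.

Definition input_ok s : Prop :=
  [/\ ireg s rN = n, forall i j : 'I_n, rarr s aC i j = C i j,
      forall i : 'I_n, rarr s aP i 0%N = p i,
      forall j : 'I_n, rarr s aQ j 0%N = q j & rarr s aEps 0%N 0%N = eps].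

Lemma input_ok_frame s s' : ireg s' rN = ireg s rN ->
  (forall a, (a < 4)%N -> rarr s' a = rarr s a) -> input_ok s -> input_ok s'.
Proof.
by move=> fi fa [sn sC sp sq seps]; split=> *; rewrite ?fi ?fa//= ?sC ?sp ?sq.
Qed.

Local Notation c := (fun i j => C i j / M).

Lemma PlanLoop_spec t s : input_ok s -> rarr s aMax 0%N 0%N = M ->
  ireg s rT = t.+1 ->
  (forall j : 'I_n, rarr s aPen j 0%N = penalty (iterate c p q t) j) ->
  (forall i j : 'I_n, rarr s aX i j = total c p q t i j) ->
  runs n PlanLoop s (fun s' =>
    (forall i j : 'I_n, rarr s' aPlan i j = p i * plan c p q t.+1 i j) /\
    (forall i j : 'I_n, rarr s' aX i j = total c p q t.+1 i j)).
Proof.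
move=> [sn sC sp sq seps] sM sT spen sX.
(* Entries are processed in lexicographic order; b tells which are finished. *)
pose done (b : 'I_n -> 'I_n -> bool) (A : nat -> nat -> nat -> R) :=
  forall i j : 'I_n,
    (b i j -> A aPlan i j = p i * plan c p q t.+1 i j) /\
    A aX i j = if b i j then total c p q t.+1 i j else total c p q t i j.
apply: (runs_for (Inv := fun k => done (fun i _ => (i < k)%N))) => //.
- move=> k s1 kn s1I fi fa inv; have k_ord : k = Ordinal kn :> nat by [].
  have fi1 : ireg s1 rT = t.+1 by rewrite fi.
  pose w (j : nat) := expR (- ((t.+1%:R * (rarr s aC k j / M) + rarr s aPen j 0%N) / 52)).
  have wE (s2 : state R) m : ireg s2 rT = t.+1 -> ireg s2 rI = k -> ireg s2 rJ = m ->
      rarr s2 aC = rarr s aC -> rarr s2 aPen = rarr s aPen ->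
      rarr s2 aMax = rarr s aMax -> reval s2 weight = w m.
    move=> e1 e2 e3 e4 e5 e6 /=; by rewrite e1 e2 e3 e4 e5 e6 sM !divE sub0r.
  apply: runs_seq; apply: (runs_sum (val := w)) => //.
  - by rewrite fi.
  - move=> m s2 mn s2J gi ga; by apply: wE; rewrite // ?(gi rT) ?(gi rI) ?ga// fa.
  move=> s2 gi ga sumE.
  pose Z := \sum_(m < n) w m.
  have s2Z : rarr s2 aSum 0%N 0%N = Z by rewrite sumE.
  apply: (runs_for (Inv := fun m => done (fun i j =>
     ((i < k)%N || (i == k :> nat) && (j < m)%N)))) => //.
  - by rewrite gi// fi.
  - move=> i j; rewrite ltn0 andbF orbF !ga//; exact: inv.
  - move=> m s3 mn s3J hi ha inv3.
    have w3 : reval s3 weight = w m.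
      by apply: wE; rewrite // ?(hi rT) ?(hi rI) ?(gi rT) ?(gi rI) ?ha ?ga// fa.
    apply: runs_seq; apply: runs_setr; apply: runs_setr.
    have [s3I s3Z] : ireg s3 rI = k /\ rarr s3 aSum 0%N 0%N = Z by rewrite hi// gi// ha.
    have s3P : rarr s3 aP k 0%N = p (Ordinal kn) by rewrite ha// ga// fa// (sp (Ordinal kn)).
    move=> i j; have [inv_plan inv_X] := inv3 i j.
    move: w3; rewrite /= s3I s3J s3Z !eqxx/= s3P => ->; rewrite divE.
    case: ifPn => [/andP[/eqP ik /eqP jm]|ne]; last first.
      have -> : (j < m.+1)%N = (j == m :> nat) || (j < m)%N by rewrite ltnS leq_eqVlt.
      by rewrite andb_orr (negPf ne).
    have iE : i = Ordinal kn by apply: val_inj.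
    have gE : w m / Z = plan c p q t.+1 i j.
      have wE' (l : 'I_n) : w l = expR (- ((t.+1%:R * (C i l / M)
          + penalty (iterate c p q t) l) / 52)).
        by rewrite /w spen -sC ik.
      by rewrite -jm wE' /Z; under eq_bigr do rewrite wE'.
    rewrite gE -iE ik jm ltnn eqxx ltnSn/=; split=> //.
    have -> : total c p q t.+1 i j = total c p q t i j + p i * plan c p q t.+1 i j.
      by rewrite /total big_ord_recr.
    by move: inv_X; rewrite ik jm ltnn eqxx ltnn/= => ->.
  - move=> s3 hi ha inv3 i j; rewrite ltnS leq_eqVlt orbC.
    by have := inv3 i j; rewrite ltn_ord andbT.
- move=> s' fi fa inv; split=> i j.
    by have [+ _] := inv i j; apply; rewrite ltn_ord.
  by have [_] := inv i j; rewrite ltn_ord.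
Qed.


Lemma PotentialLoop_spec t s : input_ok s -> ireg s rT = t.+1 ->
  (forall i j : 'I_n, rarr s aPlan i j = p i * plan c p q t.+1 i j) ->
  (forall j : 'I_n, rarr s aPast j 0%N = past (iterate c p q t) j) ->
  (forall j : 'I_n, rarr s aLoad j 0%N = load (iterate c p q t) j) ->
  runs n PotentialLoop s (fun s' => forall j : 'I_n,
    [/\ rarr s' aPast j 0%N = past (iterate c p q t.+1) j,
        rarr s' aLoad j 0%N = load (iterate c p q t.+1) j
      & rarr s' aPen j 0%N = penalty (iterate c p q t.+1) j]).
Proof.
move=> [sn sC sp sq seps] sT splan spast sload.
pose Inv k (A : nat -> nat -> nat -> R) := forall j : 'I_n,
  [/\ A aPast j 0%N = past (iterate c p q (if (j < k)%N then t.+1 else t)) j,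
      A aLoad j 0%N = load (iterate c p q (if (j < k)%N then t.+1 else t)) j
    & (j < k)%N -> A aPen j 0%N = penalty (iterate c p q t.+1) j].
apply: (runs_for (Inv := Inv)) => // [k s1 kn s1J fi fa inv|s' _ _ inv j].
  pose j := Ordinal kn.
  apply: runs_seq; apply: (runs_sum (val := fun m => rarr s aPlan m k)) => //.
  - by rewrite fi.
  - by move=> s2 /= ->.
  - by move=> m s2 mn s2I gi ga /=; rewrite s2I gi// s1J ga// fa.
  move=> s2 gi ga sumE.
  have s2J : ireg s2 rJ = k by rewrite gi.
  have s2T : ireg s2 rT = t.+1 by rewrite gi// fi.
  have colE : rarr s2 aCol k 0%N = colmass p (plan c p q t.+1) j.
    by rewrite sumE/= s1J !eqxx/=; apply: eq_bigr => i _; rewrite -splan.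
  have loadE : rarr s2 aLoad k 0%N = load (iterate c p q t) j.
    by rewrite ga//; have [_] := inv j; rewrite ltnn.
  have pastE : rarr s2 aPast k 0%N = past (iterate c p q t) j.
    by rewrite ga//; have [+ _] := inv j; rewrite ltnn.
  have qE : rarr s2 aQ k 0%N = q j by rewrite ga// fa// (sq j).
  apply: runs_seq; apply: runs_setr; apply: runs_seq; apply: runs_setr.
  rewrite /= s2J s2T !eqxx/= loadE colE qE divE.
  set s3 := set_rarr _ aPot _ _ _.
  have s3J : ireg s3 rJ = k by [].
  have s3pot : clip (rarr s3 aPot k 0%N) = potential (iterate c p q t.+1) j.
    by rewrite /= !eqxx.
  have s3A a l : a != aLoad -> a != aPot -> a != aCol ->
      rarr s3 a l 0%N = rarr s1 a l 0%N.
    by move=> /negPf a1 /negPf a2 a3; rewrite /= a1 a2 ga.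
  have s3load l : rarr s3 aLoad l 0%N =
      if l == k then load (iterate c p q t.+1) j else rarr s1 aLoad l 0%N.
    by rewrite /= ga// andbT.
  move: s3 => s3 in s3J s3pot s3A s3load *.
  apply: runs_seq; apply: (@runs_frame _ _ _ _ (fun s' =>
      rarr s' aPot k 0%N = potential (iterate c p q t.+1) j)).
    rewrite -s3pot /clip; apply: runs_if => /= [|/negPf]; rewrite s3J => ->.
      by apply: runs_setr; rewrite /= s3J !eqxx.
    apply: runs_if => /= [|/negPf]; rewrite s3J sub0r => ->.
      by apply: runs_setr; rewrite /= s3J !eqxx sub0r.
    exact: runs_skip.
  move=> s4 s4pot [gi4 ga4].
  have s4J : ireg s4 rJ = k by rewrite gi4.
  apply: runs_seq; apply: runs_setr; apply: runs_setr => l /=.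
  rewrite s4J !eqxx/= s4pot !ga4// s3load !s3A// !andbT.
  have [pastl loadl penl] := inv l; have [pastj _ _] := inv j.
  rewrite ltnn in pastj.
  rewrite [(l < k.+1)%N]ltnS leq_eqVlt; case: eqVneq => [lk|ne] /=; last by split.
  have -> : l = j by apply: val_inj.
  by rewrite pastj; split.
by have := inv j; rewrite ltn_ord => -[? ? /(_ isT)].
Qed.


(** The machine state mirrors t rounds of the iteration for the costs C / M. *)
Definition sim t s : Prop :=
  [/\ input_ok s, rarr s aMax 0%N 0%N = M, ireg s rT = t,
      forall j : 'I_n, [/\ rarr s aPast j 0%N = past (iterate c p q t) j,
        rarr s aLoad j 0%N = load (iterate c p q t) j
      & rarr s aPen j 0%N = penalty (iterate c p q t) j]
    & forall i j : 'I_n, rarr s aX i j = total c p q t i j].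

Lemma Iteration_spec t s : sim t s -> runs n Iteration s (sim t.+1).
Proof.
move=> [[sn sC sp sq seps] sM sT sdual sX].
apply: runs_seq; apply: runs_seti; rewrite /= sT addn1.
set s1 := set_ireg _ _ _.
have s1ok : input_ok s1 by [].
apply: runs_seq; apply: (runs_frame (@PlanLoop_spec t s1 _ _ _ _ _)) => //.
  by move=> j; have [] := sdual j.
move=> s2 [s2plan s2X] [gi ga].
have s2ok : input_ok s2.
  by split=> *; rewrite ?gi ?ga//= ?sC ?sp ?sq.
apply: (runs_frame (@PotentialLoop_spec t s2 s2ok _ _ _ _)) => //.
- by rewrite gi.
- by move=> j; rewrite ga//; have [] := sdual j.
- by move=> j; rewrite ga//; have [] := sdual j.
move=> s3 s3dual [hi ha]; split=> //.
- by split=> *; rewrite ?hi ?ha ?gi ?ga//= ?sC ?sp ?sq.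
- by rewrite ha// ga.
- by rewrite hi// gi.
- by move=> i j; rewrite ha.
Qed.

Lemma MaxLoop_spec s B : input_ok s -> rarr s aMax 0%N 0%N = 0 -> 0 <= B ->
  (forall i j, C i j <= B) ->
  runs n MaxLoop s (fun s' => 0 <= rarr s' aMax 0%N 0%N <= B /\
    forall i j, C i j <= rarr s' aMax 0%N 0%N).
Proof.
move=> [sn sC sp sq seps] s0 B0 CB.
(* b tells which entries have been scanned. *)
pose Inv (b : nat -> nat -> bool) (A : nat -> nat -> nat -> R) :=
  0 <= A aMax 0%N 0%N <= B /\
  forall i j : 'I_n, b i j -> C i j <= A aMax 0%N 0%N.
apply: (runs_for (Inv := fun k => Inv (fun i _ => (i < k)%N))) => //.
- by split=> //; rewrite s0 lexx.
- move=> k s1 kn s1I fi fa inv1.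
  apply: (runs_for (Inv := fun l => Inv (fun i j =>
    (i < k)%N || (i == k) && (j < l)%N))) => //; first by rewrite fi.
  + by case: inv1 => ? h; split=> // i j; rewrite andbF orbF; exact: h.
  + move=> l s2 ln s2J gi ga [inv2 inv2'].
    have s2I : ireg s2 rI = k by rewrite gi.
    have s2C : rarr s2 aC k l = C (Ordinal kn) (Ordinal ln).
      by rewrite ga// fa// (sC (Ordinal kn) (Ordinal ln)).
    have split_last (i j : 'I_n) : (i < k)%N || (i == k :> nat) && (j < l.+1)%N ->
        ((i < k)%N || (i == k :> nat) && (j < l)%N) \/
        i = Ordinal kn /\ j = Ordinal ln.
      move=> /orP[->|/andP[/eqP ik]]; first by left.
      rewrite ltnS leq_eqVlt => /orP[/eqP jl|->]; last by left; rewrite ik eqxx orbT.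
      by right; split; apply: val_inj.
    apply: runs_if => /=; rewrite s2I s2J s2C => h.
      apply: runs_setr; split=> /= [|i j].
        by rewrite s2I s2J s2C CB andbT; case/andP: inv2 => /le_trans ->.
      rewrite s2I s2J s2C => /split_last[/inv2' h2|[-> ->]]//; exact: le_trans h2 h.
    apply: runs_skip; split=> // i j /split_last[/inv2'//|[-> ->]].
    by rewrite ltW// ltNge.
  + move=> s2 gi ga [inv2 inv2']; split=> // i j.
    rewrite ltnS leq_eqVlt orbC => h; apply: inv2'; by rewrite ltn_ord andbT.
- by move=> s' fi fa [h1 h2]; split=> // i j; apply: h2; rewrite ltn_ord.
Qed.

Lemma RoundLoops_spec t s (X : 'I_n -> 'I_n -> R) : input_ok s -> ireg s rT = t ->
  (forall i j : 'I_n, rarr s aX i j = X i j) ->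
  runs n RoundLoops s (fun s' => forall i j : 'I_n,
    rarr s' aX i j = rounding p q (fun i j => X i j / t%:R) i j).
Proof.
move=> sok sT sX; set Y := (fun i j => X i j / t%:R).
apply: runs_seq; apply: (@runs_frame _ _ _ _ (fun s' =>
    forall i j : 'I_n, rarr s' aX i j = Y i j)).
  apply: (runs_for (Inv := fun k A => forall i j : 'I_n,
      A aX i j = if (i < k)%N then Y i j else X i j)) => //.
  - by case: sok.
  - move=> k s1 kn s1I fi fa inv.
    apply: (runs_row (val := fun l => rarr s1 aX k l / t%:R)) => //.
    + by rewrite fi//; case: sok.
    + move=> l s2 ln s2J gi ga; rewrite s1I /= => eX.
      by rewrite (gi rI)// (gi rT)// s1I s2J eX fi// sT divE.
    + move=> s2 gi ga eX i j; rewrite eX s1I ltn_ord andbT inv.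
      rewrite [(i < k.+1)%N]ltnS [(i <= k)%N]leq_eqVlt.
      by case: eqVneq => [ik|ne] //=; rewrite -ik inv ik ltnn.
  - by move=> s' _ _ inv i j; rewrite inv ltn_ord.
move=> s1 s1X [fi fa].
have {fi fa sok}s1ok : input_ok s1.
  by apply: input_ok_frame sok; [exact: fi|case=> [|[|[|[|]]]]// _; exact: fa].
apply: runs_seq; apply: (@runs_frame _ _ _ _ (fun s' =>
    (forall i j : 'I_n, rarr s' aX i j = trim q Y i j) /\
    forall j : 'I_n, rarr s' aCdef j 0%N = col_deficit q Y j)).
  apply: (runs_for (Inv := fun k A => forall j : 'I_n,
      (forall i : 'I_n, A aX i j = if (j < k)%N then trim q Y i j else Y i j) /\
      ((j < k)%N -> A aCdef j 0%N = col_deficit q Y j))) => //.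
  - by case: s1ok.
  - move=> k s2 kn s2J fi fa inv; pose j := Ordinal kn.
    have s2X (i : 'I_n) : rarr s2 aX i k = Y i j.
      by have [-> _] := inv j; rewrite ltnn.
    have s2n : ireg s2 rN = n by rewrite fi//; case: s1ok.
    apply: runs_seq; apply: (runs_sum (val := fun m => rarr s2 aX m k)) => //.
    + by move=> s3 /= ->.
    + by move=> m s3 mn s3I gi ga /=; rewrite s3I gi// s2J ga.
    move=> s3 gi ga sumE.
    have s3J : ireg s3 rJ = k by rewrite gi.
    have s3col : rarr s3 aCol k 0%N = colsum Y j.
      by rewrite sumE/= s2J !eqxx/=; apply: eq_bigr => i _; rewrite s2X.
    have s3q : rarr s3 aQ k 0%N = q j.
      by rewrite ga// fa//; case: s1ok => _ _ _ /(_ j).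
    have split_last (l : 'I_n) : (l < k.+1)%N -> l = j \/ ((l == k :> nat) = false /\ (l < k)%N).
      rewrite ltnS leq_eqVlt; case: eqVneq => [lk _|_ /= lk]; last by right.
      by left; apply: val_inj.
    apply: runs_if => /= h; rewrite s3J s3col s3q in h.
      apply: runs_setr => /= l; rewrite s3J s3col s3q !ga// andbT.
      have [invX invD] := inv l; split=> [i|/split_last[->|[-> lk]]].
      * rewrite invX; case: ltnP => lk; first by rewrite ltnW// ltnS ltnW.
        case: ifP => // /split_last[->|[_]]; last by rewrite ltnNge lk.
        by rewrite /trim h.
      * by rewrite eqxx/= /col_deficit h.
      * exact: invD.
    apply: runs_seq; apply: runs_setr; set s4 := set_rarr _ _ _ _ _.
    have s4J : ireg s4 rJ = k by [].
    apply: (runs_col (val := fun m => rarr s2 aX m k * q j / colsum Y j)) => //.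
    + by rewrite /= gi.
    + move=> m s5 mn s5I hi ha /= e; rewrite s3J in e.
      by rewrite s5I hi// s4J e !ha//= s3q s3col divE ga.
    move=> s5 hi ha eX l; have [invX invD] := inv l; split=> [i|lk].
      rewrite eX ltn_ord/= s3J; case: eqVneq => [lk|ne].
        have -> : l = j by apply: val_inj.
        by rewrite /= ltnSn s2X /trim (negPf h).
      rewrite ga// invX; case: ltnP => lk; first by rewrite ltnW// ltnS ltnW.
      by rewrite ltnS leq_eqVlt (negPf ne) ltnNge lk.
    rewrite ha//= s3J andbT; case: (split_last _ lk) => [->|[-> lk']].
      by rewrite eqxx/= /col_deficit (negPf h).
    by rewrite ga//; exact: invD.
  - move=> s2 _ _ inv; split=> [i j|j]; first by have [-> _] := inv j; rewrite ltn_ord.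
    by have [_] := inv j; apply; rewrite ltn_ord.
move=> s2 [s2X s2D] [fi fa].
have {fi fa s1ok}s2ok : input_ok s2.
  by apply: input_ok_frame s1ok; [exact: fi|case=> [|[|[|[|]]]]// _; exact: fa].
apply: runs_seq; apply: (runs_sum (val := fun l => rarr s2 aCdef l 0%N)) => //.
- by case: s2ok.
- by move=> l s3 ln s3J gi ga /=; rewrite s3J ga.
move=> s3 gi ga sumE.
have s3def : rarr s3 aDef 0%N 0%N = deficit q Y.
  by rewrite sumE/=; apply: eq_bigr => l _; rewrite s2D.
have s3ok : input_ok s3.
  by apply: input_ok_frame s2ok; [exact: gi|case=> [|[|[|[|]]]]// _; exact: ga].
apply: (runs_for (Inv := fun k A => forall i j : 'I_n,
    A aX i j = if (i < k)%N then rounding p q Y i j else trim q Y i j)) => //.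
- by case: s3ok.
- by move=> i j; rewrite ga.
- move=> k s4 kn s4I hi ha inv; pose i := Ordinal kn.
  have s4n : ireg s4 rN = n by rewrite hi//; case: s3ok.
  have s4X (j : 'I_n) : rarr s4 aX k j = trim q Y i j by rewrite (inv i) ltnn.
  apply: runs_seq; apply: (runs_sum (val := fun m => rarr s4 aX k m)) => //.
  + by move=> m s5 mn s5J ki ka /=; rewrite s5J ki// s4I ka.
  move=> s5 ki ka sumX.
  have s5I : ireg s5 rI = k by rewrite ki.
  have s5p : rarr s5 aP k 0%N = p i by rewrite ka// ha//; case: s3ok => _ _ /(_ i).
  have s5sum : rarr s5 aSum 0%N 0%N = \sum_j trim q Y i j.
    by rewrite sumX/=; apply: eq_bigr => j _; rewrite s4X.
  have s5def : rarr s5 aDef 0%N 0%N = deficit q Y by rewrite ka// ha.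
  apply: (runs_row (val := fun l => rarr s4 aX k l +
     row_deficit p q Y i * rarr s4 aCdef l 0%N / deficit q Y)) => //.
  + by rewrite ki.
  + move=> l s6 ln s6J li la /= e; rewrite li// s6J s5I in e *.
    by rewrite e !la// s5p s5sum s5def divE !ka.
  + move=> s6 li la eX i' j; rewrite eX s5I ltn_ord andbT.
    case: eqVneq => [ik|ne].
      have -> : i' = i by apply: val_inj.
      by rewrite /= ltnSn s4X /rounding ha// ga// s2D.
    rewrite ka// inv; congr (if _ then _ else _).
    by rewrite [RHS]ltnS [RHS]leq_eqVlt (negPf ne).
- by move=> s4 _ _ inv i j; rewrite inv ltn_ord.
Qed.

End Specs.

(** * Accuracy and running time *)

Section Assembly.
Variables (R : realType) (n : nat).

Lemma ot_feasibleP (p q : 'cV[R]_n) (X : 'M[R]_n) : ot_feasible p q X <->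
  [/\ forall i j, 0 <= X i j, forall i, \sum_j X i j = p i 0
    & forall j, \sum_i X i j = q j 0].
Proof.
have rowE i : (X *m const_mx 1 : 'cV_n) i 0 = \sum_j X i j.
  by rewrite mxE; apply: eq_bigr => j _; rewrite mxE mulr1.
have colE j : (X^T *m const_mx 1 : 'cV_n) j 0 = \sum_i X i j.
  by rewrite mxE; apply: eq_bigr => i _; rewrite !mxE mulr1.
split=> -[X0 Xp Xq]; split=> //.
- by move=> i; rewrite -rowE Xp.
- by move=> j; rewrite -colE Xq.
- by apply/colP => i; rewrite rowE.
- by apply/colP => j; rewrite colE.
Qed.

Lemma approx_ot_map_of_le (C : 'M[R]_n) (p q : 'cV[R]_n) (eps : R) (X : 'M[R]_n) :
  ot_feasible p q X ->
  (forall U, ot_feasible p q U -> ot_cost C X <= ot_cost C U + eps) ->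
  approx_ot_map C p q eps X.
Proof.
move=> fX hX; split=> //; rewrite -lerBlDr; apply: lb_le_inf.
  by exists (ot_cost C X), X.
by move=> _ [U fU <-]; rewrite lerBlDr; exact: hX.
Qed.

Lemma simplex_sum (p : 'cV[R]_n) : simplex p -> \sum_i p i 0 = 1.
Proof. by case=> p0 <-; apply: eq_bigr => i _; rewrite ger0_norm. Qed.

Lemma load_mxE (m k : nat) (A : 'M[R]_(m, k)) (i : 'I_m) (j : 'I_k) :
  load_mx A i j = A i j.
Proof. by rewrite /load_mx !valK. Qed.

Lemma entry_le_mx_norm (C : 'M[R]_n) i j : C i j <= mx_norm C.
Proof.
rewrite mx_normrE (le_trans (ler_norm _))//.
exact: (le_bigmax _ (fun ij : 'I_n * 'I_n => `|C ij.1 ij.2|) (i, j)).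
Qed.

Lemma mx_norm_ge0 (C : 'M[R]_n) : 0 <= mx_norm C.
Proof. by rewrite mx_normrE; exact: bigmax_ge_id. Qed.

Lemma ln_ge_half : (1 < n)%N -> 1 / 2 <= ln n%:R :> R.
Proof.
move=> n2; rewrite -[1 / 2]expRK ler_ln ?posrE ?expR_gt0 ?ltr0n ?(ltnW n2)//.
apply: le_trans (expR_le_quad _) _; first by rewrite ger0_norm; lra.
by apply: (@le_trans _ _ 2%:R); [lra | rewrite ler_nat].
Qed.

Lemma ot_input_ok (C : 'M[R]_n) (p q : 'cV[R]_n) (eps : R) :
  input_ok C (p ^~ 0) (q ^~ 0) eps (ot_input C p q eps).
Proof.
split=> //= [i j|i|j|]; first exact: load_mxE.
- exact: (load_mxE p i ord0).
- exact: (load_mxE q j ord0).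
- by rewrite (load_mxE _ (ord0 : 'I_1) (ord0 : 'I_1)) mxE.
Qed.

(** The first round at which the stopping rule holds. *)
Lemma horizon (B eps : R) : 0 < B -> 0 < eps -> exists T : nat,
  [/\ (0 < T)%N, B <= T%:R * eps, forall k, (k < T)%N -> k%:R * eps < B
    & T%:R <= B / eps + 1].
Proof.
move=> B0 e0.
have exP : exists k : nat, B <= k%:R * eps.
  exists (Num.bound (B / eps)); rewrite -ler_pdivrMr//; apply/ltW/archi_boundP.
  by rewrite divr_ge0// ltW.
case: (ex_minnP exP) => T hT minT; exists T.
have T0 : (0 < T)%N by case: T hT {minT} => //; rewrite mul0r leNgt B0.
have below k : (k < T)%N -> k%:R * eps < B.
  by move=> kT; rewrite ltNge; apply/negP => /minT; rewrite leqNgt kT.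
split=> //; rewrite -lerBlDr ler_pdivlMr//.
have -> : T%:R - 1 = T.-1%:R :> R by rewrite -{1}(prednK T0) -natr1 addrK.
by rewrite ltW// below// ltn_predL.
Qed.

Variables (C : 'M[R]_n) (p q : 'cV[R]_n) (eps : R).
Hypotheses (C_ge0 : forall i j, 0 <= C i j) (ps : simplex p) (qs : simplex q).
Hypothesis eps_gt0 : 0 < eps.

Local Notation p' := (p ^~ 0).
Local Notation q' := (q ^~ 0).

Lemma rounding_approx (X : 'I_n -> 'I_n -> R) :
  (forall i j, 0 <= X i j) -> (forall i, \sum_j X i j <= p i 0) ->
  (forall U : 'M[R]_n, ot_feasible p q U ->
    \sum_i \sum_j C i j * rounding p' q' X i j <= ot_cost C U + eps) ->
  approx_ot_map C p q eps (\matrix_(i, j) rounding p' q' X i j).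
Proof.
have [p0 _] := ps; have [q0 _] := qs.
move=> X0 Xr hU; apply: approx_ot_map_of_le.
  apply/ot_feasibleP; split=> [i j|i|j].
  - by rewrite mxE; apply: rounding_ge0.
  - by under eq_bigr do rewrite mxE; apply: (rounding_row (p := p')); rewrite ?simplex_sum.
  - by under eq_bigr do rewrite mxE; apply: (rounding_col (q := q')); rewrite ?simplex_sum.
move=> U fU; apply: le_trans (hU U fU); rewrite le_eqVlt; apply/orP; left.
by apply/eqP; apply: eq_bigr => i _; apply: eq_bigr => j _; rewrite mxE.
Qed.

Lemma average_approx (M : R) (T : nat) : (0 < T)%N -> 0 < M ->
  (forall i j, C i j <= M) -> (52 * ln n%:R + 21) * M <= T%:R * eps ->
  approx_ot_map C p q eps
    (\matrix_(i, j) rounding p' q' (average C p' q' M T) i j).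
Proof.
have [p0 _] := ps; have [q0 _] := qs.
move=> T0 M0 CM hT; apply: rounding_approx => [i j|i|U /ot_feasibleP[U0 Ur Uc]].
- exact: average_ge0.
- by rewrite average_row.
- apply: average_gap => //; rewrite ?simplex_sum// => i j; by rewrite C_ge0 CM.
Qed.

(** Rounding the zero matrix gives the product plan.  It costs at most M, and for
n = 1 it is the only plan. *)
Lemma product_approx (M : R) (X : 'I_n -> 'I_n -> R) : (forall i j, X i j = 0) ->
  (forall i j, C i j <= M) -> (n <= 1)%N || (M <= eps) ->
  approx_ot_map C p q eps (\matrix_(i, j) rounding p' q' X i j).
Proof.
have [p0 _] := ps; have [q0 _] := qs.
move=> X0 CM h.
have Xr i : \sum_j X i j <= p i 0 by rewrite big1.
have X_ge0 i j : 0 <= X i j by rewrite X0.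
apply: rounding_approx => // U /ot_feasibleP[U0 Ur Uc].
have [n1|n1] := leqP n 1.
  rewrite -[leLHS]addr0 lerD ?(ltW eps_gt0)//.
  rewrite le_eqVlt; apply/orP; left; apply/eqP.
  apply: eq_bigr => i _; apply: eq_bigr => j _; congr (_ * _).
  have only (F : 'I_n -> R) : \sum_k F k = F j.
    rewrite (bigD1 j)//= big1 ?addr0// => k; have := ltn_ord k; have := ltn_ord j.
    by move=> hj hk /eqP[]; apply: val_inj => /=; lia.
  have := @rounding_row _ _ p' q' X q0 (simplex_sum ps) (simplex_sum qs) X_ge0 Xr i.
  by rewrite only -Ur only.
have {h}Me : M <= eps by move: h; rewrite leqNgt n1.
have CM' i j : 0 <= C i j <= M by rewrite C_ge0 CM.
have := @rounding_cost _ _ p' q' X q0 (simplex_sum ps) (simplex_sum qs) X_ge0 Xr _ _ CM'.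
have -> : deficit q' X = 1.
  rewrite -(simplex_sum qs); apply: eq_bigr => j _.
  by rewrite /col_deficit /colsum big1// q0 subr0.
rewrite [X in _ <= X + _]big1 => [|i _]; last first.
  by rewrite big1// => j _; rewrite X0 mulr0.
have : 0 <= ot_cost C U.
  by apply: sumr_ge0 => i _; apply: sumr_ge0 => j _; rewrite mulr_ge0.
lra.
Qed.

(** A common coefficient for the parts of the program; 100 leaves room for the
tests. *)
Definition size_factor : nat :=
  (time_bound 0 MaxLoop + time_bound 0 RoundLoops + time_bound 0 Iteration + 100)%N.

Lemma time_boundW c : (time_bound 0 c + 100 <= size_factor)%N -> depth c = 2 ->
  (time_bound n c + 100 <= size_factor * n.+1 ^ 2)%N.
Proof.
move=> h d; have := time_bound_poly n c; rewrite d.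
have : (0 < n.+1 ^ 2)%N by rewrite expn_gt0.
nia.
Qed.

(** T counts the rounds of the main loop.  In the second case eps < M, which later
hides the additive constants of the time bound in the multiple of M / eps. *)
Lemma Transport_correct : exists t s T,
  [/\ exec Transport (ot_input C p q eps) t s,
      approx_ot_map C p q eps (ot_output n s),
      (t <= size_factor * n.+1 ^ 2 * (T + 4))%N
    & T = 0%N \/ (1 < n)%N /\ exists M, [/\ eps < M, M <= mx_norm C
        & T%:R <= (52 * ln n%:R + 21) * M / eps + 1]].
Proof.
have CN := @entry_le_mx_norm C.
have s0ok := ot_input_ok C p q eps.
have [t1 [s1 [e1 h1 [/andP[M0 MN] CM]]]] :=
  MaxLoop_spec s0ok erefl (mx_norm_ge0 C) CN.
have [fi fa] := exec_frame e1.
have s1ok : input_ok C p' q' eps s1.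
  by apply: input_ok_frame s0ok; [exact: fi|case=> [|[|[|[|]]]]// _; exact: fa].
set M := rarr s1 aMax 0%N 0%N in M0 MN CM.
have s1n : ireg s1 rN = n by case: s1ok.
have s1e : rarr s1 aEps 0%N 0%N = eps by case: s1ok.
pose G := BAnd (BLeI (IConst 2) (IVar rN)) (BNot (BLeR (cell aMax) (cell aEps))).
have GE : beval s1 G = (1 < n)%N && ~~ (M <= eps) by rewrite /= s1n s1e.
have b1 := @time_boundW MaxLoop isT erefl.
have b2 := @time_boundW RoundLoops isT erefl.
have b3 := @time_boundW Iteration isT erefl.
move: size_factor b1 b2 b3 => A b1 b2 b3.
case: (boolP (beval s1 G)) => hG; last first.
  have X0 (i j : 'I_n) : rarr s1 aX i j = 0 by rewrite fa.
  have [t3 [s3 [e3 h3 q3]]] := @RoundLoops_spec R n C p' q' eps 0 s1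
    (fun _ _ => 0) s1ok (fi rT isT) X0.
  exists (t1 + ((bcost G + 1).+1 + t3))%N, s3, 0%N; split.
  - apply: exec_seq e1 _; apply: exec_seq e3.
    by apply: exec_if_false => //; exact: exec_skip.
  - rewrite [ot_output n s3](_ : _ = \matrix_(i, j)
      rounding p' q' (fun _ _ => 0 / 0%:R) i j).
      apply: (@product_approx M) => // [i j|]; first by rewrite mul0r.
      by move: hG; rewrite GE negb_and negbK -leqNgt.
    by apply/matrixP => i j; rewrite !mxE q3.
  - have := leq_trans (leq_add h1 (leqnn 100)) b1.
    have := leq_trans (leq_add h3 (leqnn 100)) b2.
    move: (A * n.+1 ^ 2)%N => W; rewrite [bcost G]/=; clear; lia.
  - by left.
have := hG; rewrite GE -ltNge => /andP[n2 eM].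
have Mpos : 0 < M by exact: lt_trans eM.
have L := ln_ge_half n2.
have [|T [T0 hT below TB]] := @horizon ((52 * ln n%:R + 21) * M) eps _ eps_gt0.
  by rewrite mulr_gt0//; lra.
have s1sim : sim C p' q' eps M 0 s1.
  split=> // [|j|i j]; first by rewrite fi.
    by split; rewrite fa//= ?addr0 /penalty/= ?expr0n/= ?addr0.
  by rewrite fa// /total big_ord0.
have contE k s : sim C p' q' eps M k s ->
    beval s Continue = (k%:R * eps < (52 * ln n%:R + 21) * M).
  move=> [[sn _ _ _ se] sM sT _ _]; rewrite /= sn sT se sM.
  by rewrite lern0 -leqn0 leqNgt (ltnW n2) -ltNge.
have [||t2 [s2 [e2 h2 s2sim]]] := @exec_while_count R n Continue Iteration T
    (sim C p' q' eps M) s1 _ _ s1sim.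
- move=> k s kT hs; rewrite (contE k)// below//; split=> //.
  exact: Iteration_spec.
- by move=> s hs; rewrite (contE T)// -leNgt.
have [s2ok s2M s2T _ s2X] := s2sim.
have [t3 [s3 [e3 h3 q3]]] := RoundLoops_spec s2ok s2T s2X.
exists (t1 + ((bcost G + t2).+1 + t3))%N, s3, T; split.
- apply: exec_seq e1 _; apply: exec_seq e3; exact: exec_if_true.
- rewrite [ot_output n s3](_ : _ = \matrix_(i, j)
      rounding p' q' (average C p' q' M T) i j); first exact: average_approx.
  by apply/matrixP => i j; rewrite !mxE q3.
- have h2' : (t2 <= T.+1 * (A * n.+1 ^ 2))%N.
    apply: leq_trans h2 (leq_mul (leqnn _) _); apply: leq_trans b3.
    by rewrite [leqRHS]addnC -addSn leq_add2r.
  have := leq_trans (leq_add h1 (leqnn 100)) b1.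
  have := leq_trans (leq_add h3 (leqnn 100)) b2.
  move: h2'; move: (A * n.+1 ^ 2)%N => W; rewrite [bcost G]/=; clear; nia.
- by right; split=> //; exists M.
Qed.

End Assembly.

Theorem corollary7 (R : realType) :
  exists (prog : cmd) (K : R),
    forall (n : nat) (C : 'M[R]_n) (p q : 'cV[R]_n) (eps : R),
      (forall i j, 0 <= C i j) -> simplex p -> simplex q -> 0 < eps ->
      exists (t : nat) (s : state R),
        [/\ exec prog (ot_input C p q eps) t s,
            approx_ot_map C p q eps (ot_output n s)
          & t%:R <= K * Num.max (n%:R ^+ 2)
                                (n%:R ^+ 2 * ln n%:R * mx_norm C * eps^-1)].
Proof.
pose A : R := size_factor%:R.
exists Transport, (416 * A) => n C p q eps C0 ps qs e0.
have [t [s [T [ex ap tT hT]]]] := Transport_correct C0 ps qs e0.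
exists t, s; split=> //.
have n0 : (0 < n)%N.
  case: (n) p ps {tT hT ex ap s qs C0 C q} => // p /simplex_sum.
  by rewrite big_ord0 => /eqP; rewrite eq_sym oner_eq0.
have A0 : 0 <= A by exact: ler0n.
have {tT}tR : t%:R <= 4 * A * n%:R ^+ 2 * (T%:R + 4).
  apply: (@le_trans _ _ (size_factor * n.+1 ^ 2 * (T + 4))%:R).
    by rewrite ler_nat.
  rewrite !natrM natrD ler_wpM2r ?addr_ge0// -/A [4 * A]mulrC -mulrA ler_wpM2l//.
  have : 1 <= n%:R :> R by rewrite ler1n.
  by rewrite -natr1; nra.
(* Keeps the large numeral behind A from being unfolded. *)
clearbody A.
have x0 : 0 <= n%:R ^+ 2 :> R by rewrite exprn_ge0.
have N0 := mx_norm_ge0 C.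
have K0 : 0 <= 416 * A by lra.
case: hT => [T0|[n2 [M [eM MN TB]]]].
  apply: (le_trans tR); rewrite T0 add0r.
  apply: (@le_trans _ _ (416 * A * n%:R ^+ 2)); first by have := mulr_ge0 A0 x0; lra.
  by apply: (ler_wpM2l K0); rewrite le_max lexx.
have L := @ln_ge_half R n n2.
apply: (@le_trans _ _ (416 * A * (n%:R ^+ 2 * ln n%:R * mx_norm C * eps^-1)));
  last by apply: (ler_wpM2l K0); rewrite le_max lexx orbT.
have r1 : 1 <= mx_norm C / eps by rewrite ler_pdivlMr// mul1r ltW// (lt_le_trans eM).
have r2 : M / eps <= mx_norm C / eps by rewrite ler_pM2r ?invr_gt0.
have T1 : T%:R <= (52 * ln n%:R + 21) * (mx_norm C / eps) + 1.
  apply: (le_trans TB); have c0 : 0 <= 52 * ln n%:R + 21 :> R by lra.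
  have := ler_wpM2l c0 r2; lra.
(* With ln n >= 1/2 and N / eps >= 1 for N the largest entry:
   4 * 52 + 4 * 21 * 2 + 20 * 2 = 416. *)
have key : 4 * (T%:R + 4) <= 416 * (ln n%:R * (mx_norm C / eps)) by nra.
apply: (le_trans tR).
have := ler_wpM2l (mulr_ge0 A0 x0) key; lra.
Qed.
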